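(* Let $0<\delta\le 1$ and let $g:\mathbb{R}\to\mathbb{R}$ be a $1$-periodic function. Define $G_\delta(x)=\sum_{n=1}^{\infty}\frac{g(n^2x)}{n^{1+\delta}}$. If $g$ is differentiable and $g'$ is Lipschitz continuous on $\mathbb{R}$, then $$\overline{\dim}_{\mathrm{B}}\bigl(\mathrm{graph}(G_\delta)\bigr)\le\frac74-\frac{\delta}{2}.$$
   Context: For a continuous function $f$ on $[0,1]$ (here the restriction of $G_\delta$ to $[0,1]$), $\mathrm{graph}(f)=\{(x,f(x)):x\in[0,1]\}$. For a positive integer $N$, $A_N(f)$ is the number of grid squares $[i/N,(i+1)/N]\times[j/N,(j+1)/N]$ ($i,j\in\mathbb{Z}$) of side length $1/N$ that intersect $\mathrm{graph}(f)$. The upper box dimension is $\overline{\dim}_{\mathrm{B}}(\mathrm{graph}(f))=\limsup_{N\to\infty}\frac{\log A_N(f)}{\log N}$. *)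

(* Defs.v *)
From HB Require Import structures.
From mathcomp Require Import all_boot all_order all_algebra.
From mathcomp Require Import all_classical all_reals all_analysis.
Import Order.TTheory GRing.Theory Num.Theory.
Import numFieldNormedType.Exports.

Set Implicit Arguments.
Unset Strict Implicit.
Unset Printing Implicit Defensive.

Local Open Scope classical_set_scope.
Local Open Scope ring_scope.

Definition graph01 {R : realType} (f : R -> R) : set (R * R) :=
  [set p | 0 <= p.1 <= 1 /\ p.2 = f p.1].

(* The closed square [i/N, (i+1)/N] x [j/N, (j+1)/N], for ij = (i, j). *)
Definition grid_square (R : realType) (N : nat) (ij : int * int) :
    set (R * R) :=
  [set p | ij.1%:~R / N%:R <= p.1 <= (ij.1 + 1)%:~R / N%:R
        /\ ij.2%:~R / N%:R <= p.2 <= (ij.2 + 1)%:~R / N%:R].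

(* Cardinality in [0, +oo]: it is finite when f is continuous on [0, 1]
   and N > 0. *)
Definition box_count {R : realType} (f : R -> R) (N : nat) : \bar R :=
  counting [set ij : int * int | grid_square N ij `&` graph01 f !=set0].

(* The limsup does not depend on the meaningless terms N = 0 and N = 1. *)
Definition upper_box_dim {R : realType} (f : R -> R) : \bar R :=
  limn_esup (fun N : nat => (lne (box_count f N) / (ln N%:R)%:E)%E).

Definition G {R : realType} (g : R -> R) (delta x : R) : R :=
  limn (fun m : nat =>
    \sum_(1 <= n < m) g (n%:R ^+ 2 * x) / n%:R `^ (1 + delta)).

(* Main.v *)
Require Import Defs.
From mathcomp Require Import all_boot all_order all_algebra.
From mathcomp Require Import all_classical all_reals all_analysis.
From mathcomp Require Import complex.
From mathcomp Require Import zify ring lra.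
Import Order.TTheory GRing.Theory Num.Theory.
Import numFieldNormedType.Exports.

(** The number of boxes met by the graph in the column [[i/N, (i+1)/N]] is at most [N] times the
oscillation of [G] on that interval, plus a constant. So it suffices to bound the sum [S_N] of these
[N] oscillations by [N^(3/4 - delta/2)] up to powers of [ln N]; and an oscillation may be replaced
by [|G x - G y|] with [x], [y] arbitrary points of the interval, one pair for each [i].

Split the series into dyadic blocks [2^j <= n < 2^(j+1)] and expand [g] in a Fourier series. Since
[g'] is Lipschitz, the [k]-th coefficient is [O(k^-2)], and one is left with the exponential sums
[F(x) = \sum_n n^(-1-delta) e(k n^2 x)], [n ~ L = 2^j]. The heart of the matter is an [L^4] bound.
The equation [n1^2 + n2^2 = n3^2 + n4^2] reads [(n1-n3)(n1+n3) = (n4-n2)(n4+n2)] and therefore has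
[O(L^2 ln^2 L)] solutions of size [L] ([card_square_quads]), so that the fourth power mean of [F] is
of the order of [a^4], where [a = L^(-1/2-delta)], as if the terms were independent. The difference
quotient of [F] has the same form, with coefficients larger by a factor [k L^2].

Two elementary inequalities turn this into bounds for the sum [S_N] of the oscillations of [F],
where constants and logarithms are suppressed. Put [t = k L^2 / N]. The total variation gives
[S_N <= N t a], which is used when [t <= 1]. The sup of [|F|^4] over an
interval is at most its mean plus the variation of [|F|^4], whence the sum of the fourth powers of
the suprema is at most [N (1 + t) a^4], which is used when [t >= 1]. In both ranges the result is
[S_N <= k^(3/4) N^(3/4 - delta/2)] ([block_sum_osc_le]); the exponent of [k] is
smaller than one, so the sum over [k] with weights [k^-2] converges. There are [O(ln N)] blocks
before the tail of the series is below [1/N].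

Fourier series and integrals are avoided by sampling: all estimates concern the points [x/Q] with
[Q] a huge prime, the Fourier expansion is the finite one on [Z/Q], integrals are sums over a period,
and [k] is measured by [chord Q k], the number [Q |e(k/Q) - 1|]. *)

Set Implicit Arguments.
Unset Strict Implicit.
Unset Printing Implicit Defensive.

(** * Solutions of [n1^2 + n2^2 = n3^2 + n4^2] *)

(** Each dyadic range of [v] contributes at most [X]. *)
Lemma sum_divn_dyadic (X m : nat) : \sum_(1 <= v < 2 ^ m) X %/ v <= m * X.
Proof.
elim: m => [|m IHm]; first by rewrite expn0 big_geq.
rewrite (@big_cat_nat _ _ _ (2 ^ m)) ?expn_gt0 ?leq_exp2l //=.
rewrite mulSnr leq_add //.
apply: leq_trans (leq_divM X (2 ^ m)).
rewrite [leqRHS]mulnC -[X in X * _](addnK (2 ^ m)) addnn -mul2n -expnS.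
rewrite -sum_nat_const_nat [leqLHS]big_nat [leqRHS]big_nat; apply: leq_sum => v /andP[le_v _].
by rewrite leq_div2l ?expn_gt0.
Qed.

Definition hyperbola_pairs (X : nat) : {set 'I_X * 'I_X} :=
  [set p : 'I_X * 'I_X | [&& 0 < p.1, 0 < p.2 & p.1 * p.2 < X]].

Lemma card_hyperbola_pairs (m : nat) : #|hyperbola_pairs (2 ^ m)| <= m * 2 ^ m.
Proof.
set X := 2 ^ m.
apply: leq_trans (sum_divn_dyadic X m).
rewrite -sum1_card -/X.
have -> : \sum_(p in hyperbola_pairs X) 1 =
   \sum_(v < X | 0 < v) \sum_(u < X | (0 < u) && (u * v < X)) 1.
  rewrite (exchange_big_dep (fun u : 'I_X => 0 < u)) //=; last by move=> i j _ /andP[].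
  rewrite pair_big_dep /=; apply: eq_bigl => -[u v] /=.
  by rewrite inE /=; case: (0 < u); case: (0 < v).
have -> : \sum_(1 <= v < X) X %/ v = \sum_(v < X | 0 < v) X %/ v.
  rewrite -(big_mkord (fun v => 0 < v) (fun v => X %/ v)).
  rewrite [RHS](@big_cat_nat _ _ _ 1) ?expn_gt0 //= big_mkord [X in _ = X + _]big_pred0 ?add0n.
    by rewrite big_nat_cond [RHS]big_nat_cond; apply: eq_bigl => v; lia.
  by move=> [[]].
apply: leq_sum => v v0.
have Y0 : 0 < X %/ v by rewrite divn_gt0 // ltnW.
rewrite sum1_card; case defY: (X %/ v) Y0 => [//|Y] _.
pose f (u : 'I_X) : 'I_Y.+1 := inord u.-1.
rewrite -[leqRHS](card_ord Y.+1) -(@card_in_imset _ _ f); first exact: max_card.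
have uY (u : 'I_X) : u * v < X -> u.-1 < Y.+1.
  move=> /ltnW; rewrite -leq_divRL // defY; lia.
move=> u u'; rewrite !unfold_in => /andP[u0 uv] /andP[u'0 u'v] /(congr1 val).
rewrite /= !inordK ?uY // => e; apply/val_inj => /=; lia.
Qed.

(** The parametrization of the solutions of [a * b = c * d] by [a = u v], [b = w z], [c = u w],
[d = v z], where [u] is the gcd of [a] and [c]. *)
Definition gcd_split (q : (nat * nat) * (nat * nat)) : (nat * nat) * (nat * nat) :=
  let: ((a, b), (c, d)) := q in
  let u := gcdn a c in ((u, a %/ u), (c %/ u, b %/ (c %/ u))).

Arguments gcd_split : simpl never.

Lemma gcd_splitP (a b c d : nat) : 0 < a -> 0 < c -> a * b = c * d ->
  let r := gcd_split ((a, b), (c, d)) in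
  [/\ a = r.1.1 * r.1.2, b = r.2.1 * r.2.2, c = r.1.1 * r.2.1 & d = r.1.2 * r.2.2].
Proof.
move=> a0 c0 e; rewrite /gcd_split /=.
set u := gcdn a c.
have u0 : 0 < u by rewrite gcdn_gt0 a0.
have ea : a = u * (a %/ u) by rewrite mulnC divnK ?dvdn_gcdl.
have ec : c = u * (c %/ u) by rewrite mulnC divnK ?dvdn_gcdr.
have w0 : 0 < c %/ u by rewrite divn_gt0 // dvdn_leq ?dvdn_gcdr.
have cop : coprime (c %/ u) (a %/ u).
  rewrite coprime_sym; rewrite /coprime -(eqn_pmul2l u0) muln_gcdr -ea -ec muln1 //.
have e' : (a %/ u) * b = (c %/ u) * d.
  by apply/eqP; rewrite -(eqn_pmul2l u0) !mulnA -ea -ec e.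
have db : c %/ u %| b by rewrite -(Gauss_dvdr b cop) e' dvdn_mulr.
have eb : b = (c %/ u) * (b %/ (c %/ u)) by rewrite mulnC divnK.
by split=> //; apply/eqP; rewrite -(eqn_pmul2l w0) -e' {1}eb mulnCA.
Qed.

Definition square_quads (L : nat) : {set ('I_L * 'I_L) * ('I_L * 'I_L)} :=
  [set q : ('I_L * 'I_L) * ('I_L * 'I_L) |
    (L + q.1.1) ^ 2 + (L + q.1.2) ^ 2 == (L + q.2.1) ^ 2 + (L + q.2.2) ^ 2].

(** With [a = n1 - n3], [b = n1 + n3], [c = n4 - n2], [d = n4 + n2] the equation becomes [a b = c d];
the map to [((u, v), (w, z))] given by [gcd_split] is injective, and
[u v = a] and [w z = b] are less than [4 * 2 ^ j], which leaves few values. *)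
Lemma card_square_quads_lt (j : nat) :
  #|[set q in square_quads (2 ^ j) | q.2.1 < q.1.1]| <= (j.+2 * 2 ^ j.+2) ^ 2.
Proof.
set L := 2 ^ j; set X := 2 ^ j.+2.
have XL : X = 4 * L by rewrite /X 2!expnS mulnA.
apply: leq_trans (_ : #|finset.setX (hyperbola_pairs X) (hyperbola_pairs X)| <= _); last first.
  by rewrite cardsX -mulnn leq_mul // card_hyperbola_pairs.
have X0 : 0 < X by rewrite expn_gt0.
case defX: X X0 => [//|X'] _.
(* Both [u v = n1 - n3] and [w z = n1 + n3] are positive and less than [4 * L]; hence so are
[u], [v], [w] and [z]. *)
pose f0 (q : ('I_L * 'I_L) * ('I_L * 'I_L)) :=
  gcd_split ((q.1.1 - q.2.1, (L + q.1.1) + (L + q.2.1)),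
             (q.2.2 - q.1.2, (L + q.2.2) + (L + q.1.2))).
set A := [set q in _ | _].
have key (q : ('I_L * 'I_L) * ('I_L * 'I_L)) : q \in A ->
  let r := f0 q in
  [/\ q.1.1 - q.2.1 = r.1.1 * r.1.2, (L + q.1.1) + (L + q.2.1) = r.2.1 * r.2.2,
      q.2.2 - q.1.2 = r.1.1 * r.2.1 & (L + q.2.2) + (L + q.1.2) = r.1.2 * r.2.2]
  /\ [/\ q.2.1 < q.1.1, q.1.2 < q.2.2, q.1.1 < L, q.2.2 < L & q.2.1 < L].
  case: q => [[n1 n2] [n3 n4]]; rewrite !inE /= => /andP[/eqP e lt].
  have lt2 : n2 < n4 by nia.
  have := @gcd_splitP (n1 - n3) ((L + n1) + (L + n3)) (n4 - n2) ((L + n4) + (L + n2)).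
  rewrite !subn_gt0 lt lt2 => /(_ isT isT) H.
  have e' : (n1 - n3) * ((L + n1) + (L + n3)) = (n4 - n2) * ((L + n4) + (L + n2)) by nia.
  by split; [exact: H | split=> //; exact: ltn_ord].
clearbody f0.
pose f q : ('I_X'.+1 * 'I_X'.+1) * ('I_X'.+1 * 'I_X'.+1) :=
  let r := f0 q in ((inord r.1.1, inord r.1.2), (inord r.2.1, inord r.2.2)).
have bnd q : q \in A ->
    [/\ (f0 q).1.1 < X'.+1, (f0 q).1.2 < X'.+1, (f0 q).2.1 < X'.+1 & (f0 q).2.2 < X'.+1].
  move=> /key; move: (f0 q) => [[u v] [w z]] /= [[e1 e2 e3 e4] [h1 h2 h3 h4 h5]].
  rewrite -defX XL; have : 0 < u * v * (w * z) by rewrite -e1 -e2; nia.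
  rewrite !muln_gt0 => /andP[/andP[u0 v0] /andP[w0 z0]].
  split; nia.
rewrite -(@card_in_imset _ _ f).
  apply: subset_leq_card; apply/fintype.subsetP => _ /imsetP[q qA ->].
  have := bnd q qA; have := key q qA; rewrite !inE /f /=.
  move: (f0 q) => [[u v] [w z]] /= [[e1 e2 e3 e4] [h1 h2 h3 h4 h5]] [b1 b2 b3 b4].
  rewrite !inordK // -defX XL; have : 0 < u * v * (w * z) by rewrite -e1 -e2; nia.
  rewrite !muln_gt0 => /andP[/andP[-> ->] /andP[-> ->]] /=.
  apply/andP; split; lia.
move=> q q' qA q'A.
have := bnd q qA; have := key q qA; have := bnd q' q'A; have := key q' q'A.
rewrite /f; case: q {qA} => [[n1 n2] [n3 n4]]; case: q' {q'A} => [[m1 m2] [m3 m4]] /=.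
move: (f0 _) => [[u v] [w z]] /= [[e1 e2 e3 e4] [h1 h2 h3 h4 h5]] [b1 b2 b3 b4].
move: (f0 _) => [[u' v'] [w' z']] /= [[e1' e2' e3' e4'] [h1' h2' h3' h4' h5']] [b1' b2' b3' b4'].
move=> [] /(congr1 val) /= + /(congr1 val) /= + /(congr1 val) /= + /(congr1 val) /=.
rewrite !inordK // => E1 E2 E3 E4; subst u' v' w' z'.
congr (_, _, (_, _)); apply/val_inj => /=; lia.
Qed.

(** When [n1 = n3] also [n2 = n4], and exchanging the two sides of the equation reduces
[n1 < n3] to [n3 < n1]. *)
Lemma card_square_quads (j : nat) :
  #|square_quads (2 ^ j)| <= 33 * j.+2 ^ 2 * (2 ^ j) ^ 2.
Proof.
set L := 2 ^ j.
pose Alt := [set q in square_quads L | q.2.1 < q.1.1].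
pose Agt := [set q in square_quads L | q.1.1 < q.2.1].
pose Aeq := [set q in square_quads L | q.1.1 == q.2.1].
have -> : square_quads L = Alt :|: Agt :|: Aeq.
  by apply/finset.setP => q; rewrite !inE -!andb_orr -val_eqE /=; case: ltngtP; rewrite andbT.
have cAgt : #|Agt| <= #|Alt|.
  pose sw (q : ('I_L * 'I_L) * ('I_L * 'I_L)) := (q.2, q.1).
  rewrite -(@card_imset _ _ sw); last by move=> [q1 q2] [q3 q4] [-> ->].
  apply: subset_leq_card; apply/fintype.subsetP => _ /imsetP[q qA ->].
  by move: qA; rewrite !inE /= eq_sym.
have cAeq : #|Aeq| <= L ^ 2.
  have -> : L ^ 2 = #|{: 'I_L * 'I_L}| by rewrite card_prod !card_ord mulnn.
  rewrite -(@card_in_imset _ _ (fun q => q.1)); first exact: max_card.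
  move=> [[n1 n2] [n3 n4]] [[m1 m2] [m3 m4]]; rewrite !inE /=.
  move=> /andP[/eqP e /eqP e1] /andP[/eqP f /eqP f1] [E1 E2]; subst n3 m3 m1 m2.
  congr (_, _, (_, _)); apply/val_inj => /=; nia.
have cAlt : #|Alt| <= (j.+2 * 2 ^ j.+2) ^ 2 by exact: card_square_quads_lt.
have := (leq_card_setU (Alt :|: Agt) Aeq).1; have := (leq_card_setU Alt Agt).1.
have e4 : 2 ^ j.+2 = 4 * L by rewrite 2!expnS mulnA.
(* [1 + 2 * 4 ^ 2 = 33]. *)
have x1 : 0 < j.+2 ^ 2 by rewrite expn_gt0.
move: cAlt cAeq x1; rewrite e4 !expnMn; move: (j.+2 ^ 2) (L ^ 2) => x y.
nia.
Qed.

(** * Fourth power means of exponential sums *)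

Local Open Scope ring_scope.

Lemma sum_expr_root1 (F : fieldType) (Q : nat) (r : F) : r ^+ Q = 1 ->
  \sum_(j < Q) r ^+ j = if r == 1 then Q%:R else 0.
Proof.
move=> rQ; case: eqVneq => [->|r1].
  by rewrite (eq_bigr (fun=> 1)) ?sumr_const ?card_ord // => i _; rewrite expr1n.
apply/eqP; rewrite -(inj_eq (@mulfI _ (r - 1) _)) ?subr_eq0 // mulr0.
by rewrite -subrX1 rQ subrr.
Qed.

Lemma norm_expr_root1 (C : numClosedFieldType) (Q : nat) (w : C) :
  (0 < Q)%N -> w ^+ Q = 1 -> `|w| = 1.
Proof.
by move=> Q0 wQ; apply/eqP; rewrite -(@pexpr_eq1 _ _ Q) // -normrX wQ normr1.
Qed.

(** The fourth power of the modulus expands into a sum over quadruples, and summation over [j] kills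
all of them except those whose frequencies balance. *)
Lemma sum_norm4_le (C : numClosedFieldType) (Q : nat) (w : C) (I : finType)
    (nu : I -> nat) (b : I -> C) (beta : C) :
  (0 < Q)%N -> w ^+ Q = 1 -> (forall i, `|b i| <= beta) ->
  \sum_(j < Q) `|\sum_i b i * w ^+ (nu i * j)| ^+ 4 <=
  Q%:R * beta ^+ 4 *
    #|[set q : (I * I) * (I * I) |
        w ^+ (nu q.1.1 + nu q.1.2) == w ^+ (nu q.2.1 + nu q.2.2)]|%:R.
Proof.
move=> Q0 wQ bB.
have w1 := norm_expr_root1 Q0 wQ.
pose r (p : I * I) := w ^+ (nu p.1 + nu p.2).
pose a (p : I * I) := b p.1 * b p.2.
have rQ p : r p ^+ Q = 1 by rewrite /r -exprM mulnC exprM wQ expr1n.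
have r1 p : r p * (r p)^* = 1 by rewrite -normCK (norm_expr_root1 Q0 (rQ p)) expr1n.
have sqE (j : nat) : `|\sum_i b i * w ^+ (nu i * j)| ^+ 4 =
    \sum_(q : (I * I) * (I * I)) (a q.1 * (a q.2)^*) * (r q.1 * (r q.2)^*) ^+ j.
  rewrite (exprM _ 2 2) -normrX normCK expr2 big_distrlr pair_big /= rmorph_sum /=.
  rewrite big_distrlr pair_big /=; apply: eq_bigr => -[[i1 i2] [i3 i4]] _ /=.
  rewrite /a /r /= exprMn -rmorphXn /= -!exprM !rmorphM /= !mulnDl !exprD !rmorphM /=.
  ring.
set S := \sum_(j < Q) _.
have S0 : 0 <= S by apply: sumr_ge0 => j _; rewrite exprn_ge0.
rewrite -(ger0_norm S0) /S; under eq_bigr do rewrite sqE.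
rewrite exchange_big /=.
under eq_bigr => q _.
  rewrite -mulr_sumr sum_expr_root1; last first.
    by rewrite exprMn -rmorphXn /= !rQ rmorph1 mulr1.
  over.
apply: le_trans (ler_norm_sum _ _ _) _.
rewrite -sum1_card natr_sum mulr_sumr big_mkcond [X in _ <= X]big_mkcond /=.
apply: ler_sum => -[[i1 i2] [i3 i4]] _ /=.
rewrite inE /= -/(r (i1, i2)) -/(r (i3, i4)).
have -> : (r (i1, i2) * (r (i3, i4))^* == 1) = (r (i1, i2) == r (i3, i4)).
  apply/eqP/eqP => [e|->]; last exact: r1.
  by rewrite -[LHS]mulr1 -(r1 (i3, i4)) mulrCA e mulr1.
case: ifP => _; last by rewrite mulr0 normr0.
rewrite normrM normr_nat mulr1 mulrC ler_wpM2l ?ler0n //.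
rewrite /a /= normrM norm_conjC !normrM (exprM _ 2 2).
have b0 := le_trans (normr_ge0 _) (bB i1).
by rewrite expr2 ler_pM ?mulr_ge0 // expr2 ler_pM.
Qed.

Lemma eqn_mod_pmul2l (Q k m n : nat) : prime Q -> (0 < k < Q)%N ->
  (m < Q)%N -> (n < Q)%N -> (k * m == k * n %[mod Q])%N -> m = n.
Proof.
move=> pQ /andP[k0 kQ].
wlog le_nm : m n / (n <= m)%N.
  move=> H mQ nQ e; case: (leqP n m) => [/H|/ltnW/H]; first exact.
  by rewrite eq_sym => /(_ nQ mQ e) ->.
move=> mQ nQ; rewrite eqn_mod_dvd ?leq_mul2l ?le_nm ?orbT // -mulnBr Gauss_dvdr; last first.
  by rewrite prime_coprime // gtnNdvd.
case: (posnP (m - n)) => [|mn0 /(dvdn_leq mn0)]; lia.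
Qed.

(** The prime [Q] exceeds every sum of two squares that occurs, and [k] is invertible modulo [Q]; so the
balanced quadruples are the solutions of the equation in integers. *)
Lemma sum_norm4_squares_le (C : numClosedFieldType) (Q : nat) (w : C) (k j : nat)
    (b : 'I_(2 ^ j) -> C) (beta : C) :
  prime Q -> Q.-primitive_root w -> (0 < k < Q)%N -> (8 * (2 ^ j) ^ 2 <= Q)%N ->
  (forall i, `|b i| <= beta) ->
  \sum_(x < Q) `|\sum_i b i * w ^+ (k * (2 ^ j + i) ^ 2 * x)| ^+ 4 <=
  Q%:R * beta ^+ 4 * (33 * j.+2 ^ 2 * (2 ^ j) ^ 2)%:R.
Proof.
move=> pQ wP /andP[k0 kQ] LQ bB.
have Q0 := prime_gt0 pQ.
apply: le_trans (sum_norm4_le _ Q0 (prim_expr_order wP) bB) _.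
have beta0 : 0 <= beta.
  have i0 : 'I_(2 ^ j) by apply: (@Ordinal _ 0); rewrite expn_gt0.
  exact: le_trans (normr_ge0 _) (bB i0).
apply: ler_wpM2l; first by rewrite mulr_ge0 ?ler0n ?exprn_ge0.
rewrite ler_nat; apply: leq_trans (card_square_quads j).
apply: subset_leq_card; apply/fintype.subsetP => -[[i1 i2] [i3 i4]].
rewrite !inE /= (eq_prim_root_expr wP) -!mulnDr => /(eqn_mod_pmul2l pQ) -> //.
- by rewrite k0.
- have := ltn_ord i1; have := ltn_ord i2; nia.
- have := ltn_ord i3; have := ltn_ord i4; nia.
Qed.

(** * Finite Fourier expansion *)

Lemma sum_ord_shift (V : zmodType) (Q : nat) (h : nat -> V) :
  h Q = h 0%N -> \sum_(m < Q) h m.+1 = \sum_(m < Q) h m.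
Proof.
move=> hQ; apply: (addrI (h 0%N)).
have := big_ord_recr Q (fun i : 'I_Q.+1 => h i) (op := +%R) (idx := 0).
by rewrite big_ord_recl /= => ->; rewrite hQ addrC.
Qed.

(** Multiplication of the [k]-th coefficient by [(w ^+ k - 1) ^+ 2] amounts to taking the second
difference of [f], which is how smoothness of [f] gives decay of the coefficients. *)
Lemma dft_exists (C : numClosedFieldType) (Q : nat) (w : C) (f : nat -> C) (K : C) :
  Q.-primitive_root w -> (forall m, f (m + Q)%N = f m) ->
  (forall m, `|f m.+2 - f m.+1 *+ 2 + f m| <= K) ->
  exists c : nat -> C,
    (forall m, f m = \sum_(k < Q) c k * w ^+ (k * m)) /\
    (forall k, `|c k| * `|w ^+ k - 1| ^+ 2 <= K).
Proof.
move=> wP fQ fK.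
have Q0 := prim_order_gt0 wP; have wQ := prim_expr_order wP.
have QC : (Q%:R : C) != 0 by rewrite pnatr_eq0 -lt0n.
have w1 := norm_expr_root1 Q0 wQ.
have w0 : w != 0 by rewrite -normr_eq0 w1 oner_eq0.
pose S f k := \sum_(m < Q) f m * (w ^+ k) ^- m.
exists (fun k => S f k / Q%:R); split=> [m|k].
- have -> : f m = f (m %% Q)%N.
    rewrite {1}(divn_eq m Q) addnC; elim: (m %/ Q)%N => [|n IHn]; first by rewrite addn0.
    by rewrite mulSn [(Q + _)%N]addnC addnA fQ.
  have wm k : w ^+ (k * m) = (w ^+ (m %% Q)) ^+ k.
    by rewrite mulnC exprM prim_expr_mod.
  under eq_bigr do rewrite wm.
  set m0 := (m %% Q)%N; have m0Q : (m0 < Q)%N by rewrite ltn_mod.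
  apply: (mulIf QC); rewrite mulr_suml.
  rewrite (eq_bigr (fun k : 'I_Q => \sum_(m' < Q) f m' * (w ^+ m0 / w ^+ m') ^+ k)); last first.
    move=> k _; rewrite mulrAC mulfVK // /S mulr_suml; apply: eq_bigr => m' _.
    by rewrite exprMn exprVn -!exprM [(m' * k)%N]mulnC; ring.
  rewrite exchange_big /= (bigD1 (Ordinal m0Q)) //= [X in _ + X]big1 ?addr0.
    by rewrite -mulr_sumr sum_expr_root1 mulfV ?expf_neq0 ?eqxx ?expr1n.
  move=> m' ne; rewrite -mulr_sumr sum_expr_root1; last first.
    by rewrite exprMn exprVn !(exprAC _ _ Q) wQ !expr1n invr1 mulr1.
  case: eqP => [e|]; last by rewrite mulr0.
  case/eqP: ne; apply/val_inj => /=.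
  have /eqP : w ^+ m0 = w ^+ m' by rewrite -[LHS](divfK (expf_neq0 m' w0)) e mul1r.
  by rewrite (eq_prim_root_expr wP) !modn_small // => /eqP ->.
- have shift (h : nat -> C) : (forall m, h (m + Q)%N = h m) -> S (h \o succn) k = w ^+ k * S h k.
    move=> hQ; rewrite /S -(@sum_ord_shift _ Q (fun m => h m * (w ^+ k) ^- m)).
      rewrite mulr_sumr; apply: eq_bigr => m _ /=.
      by rewrite mulrCA; congr (_ * _); rewrite exprSr invfM mulrCA mulfV ?mulr1 ?expf_neq0.
    by rewrite -(hQ 0%N) add0n expr0 (exprAC _ k) wQ expr1n.
  have fQ1 m : (f \o succn) (m + Q)%N = (f \o succn) m by rewrite /= -addSn fQ.
  have E : S (fun m => f m.+2 - f m.+1 *+ 2 + f m) k = (w ^+ k - 1) ^+ 2 * S f k.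
    transitivity (S ((f \o succn) \o succn) k - S (f \o succn) k *+ 2 + S f k).
      rewrite /S -sumrMnl -sumrB -big_split /=; apply: eq_bigr => m _; ring.
    rewrite (shift _ fQ1) (shift _ fQ); ring.
  rewrite -normrX -normrM mulrAC mulrC -[X in _^-1 * X]mulrC -E normrM normfV normr_nat.
  rewrite ler_pdivrMl ?ltr0n //.
  apply: le_trans (ler_norm_sum _ _ _) _.
  apply: le_trans (_ : \sum_(m < Q) K <= _); last by rewrite sumr_const card_ord mulr_natl.
  apply: ler_sum => m _.
  by rewrite normrM normfV !normrX w1 !expr1n invr1 mulr1.
Qed.

(** * Roots of unity in [R[i]] *)

Local Open Scope classical_set_scope.
Local Open Scope ring_scope.

(** The modulus with values in [R]; the norm of [R[i]] takes its values in [R[i]]. *)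
Definition cmod {R : rcfType} : R[i] -> R := @ComplexField.Normc.normc R.

Lemma cmodE (R : rcfType) (z : R[i]) : `|z| = real_complex R (cmod z).
Proof. by []. Qed.

Lemma cmod_ge0 (R : rcfType) (z : R[i]) : 0 <= cmod z.
Proof. by case: z => a b; rewrite /cmod /= sqrtr_ge0. Qed.

Lemma cmodM (R : rcfType) : {morph @cmod R : x y / x * y}.
Proof. exact: ComplexField.Normc.normcM. Qed.

Lemma cmodX (R : rcfType) (z : R[i]) n : cmod (z ^+ n) = cmod z ^+ n.
Proof. by apply: complexI; rewrite rmorphXn /= -!cmodE normrX. Qed.

Lemma cmodN (R : rcfType) (z : R[i]) : cmod (- z) = cmod z.
Proof. by apply: complexI; rewrite -!cmodE normrN. Qed.

Lemma cmodD (R : rcfType) (x y : R[i]) : cmod (x + y) <= cmod x + cmod y.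
Proof. by rewrite -lecR rmorphD /= -!cmodE ler_normD. Qed.

Lemma cmodB (R : rcfType) (x y : R[i]) : cmod (x - y) <= cmod x + cmod y.
Proof. by rewrite -(cmodN y) cmodD. Qed.

Lemma cmod_sum (R : rcfType) (I : Type) (r : seq I) (P : pred I) (F : I -> R[i]) :
  cmod (\sum_(i <- r | P i) F i) <= \sum_(i <- r | P i) cmod (F i).
Proof. by rewrite -lecR rmorph_sum /= -cmodE ler_norm_sum. Qed.

Lemma cmod_real (R : rcfType) (x : R) : cmod (real_complex R x) = `|x|.
Proof. by rewrite /cmod /= expr0n /= addr0 sqrtr_sqr. Qed.

Definition cis {R : realType} (t : R) : R[i] := Complex (cos t) (sin t).

Lemma cisX (R : realType) (t : R) n : cis t ^+ n = cis (n%:R * t).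
Proof.
elim: n => [|n IHn]; first by rewrite expr0 mul0r /cis cos0 sin0.
rewrite exprS IHn -addn1 natrD mulrDl mul1r addrC /cis cosD sinD.
by apply/eqP; rewrite eq_complex /=; apply/andP; split; apply/eqP; ring.
Qed.

Lemma cmod_cis_sub1 (R : realType) (t : R) : cmod (cis (t *+ 2) - 1) = 2 * `|sin t|.
Proof.
apply: (@pexpIrn _ 2) => //; rewrite ?nnegrE ?cmod_ge0 ?mulr_ge0 //.
rewrite exprMn real_normK ?num_real // /cmod /cis /= sqr_sqrtr ?addr_ge0 ?sqr_ge0 //.
rewrite cos_mulr2n sin_mulr2n oppr0 addr0.
have := cos2Dsin2 t; move: (cos t) (sin t) => c s h.
have c2 : c ^+ 2 = 1 - s ^+ 2 by rewrite -h addrK.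
transitivity ((c ^+ 2 *+ 2 - 1 - 1) ^+ 2 + 4 * c ^+ 2 * s ^+ 2); first by ring.
rewrite c2; ring.
Qed.

(** By the mean value theorem [u cos u <= sin u]; this is applied to [u = t / 2] in
[sin t = 2 sin u cos u], where [2 cos^2 u = 1 + cos t >= 1]. *)
Lemma sin_ge_half (R : realType) (t : R) : 0 <= t <= pi / 2 -> t / 2 <= sin t.
Proof.
move=> /andP[t0 tpi]; have pi0 := pi_gt0 R.
have sc (u : R) : 0 <= u <= pi / 2 -> u * cos u <= sin u.
  move=> /andP[u0 upi].
  have [|c] := @MVT_segment R sin cos 0 u u0 (fun x _ => is_derive_sin x).
    by apply: continuous_subspaceT => x; exact: continuous_sin.
  rewrite in_itv /= => /andP[c0 cu]; rewrite sin0 !subr0 mulrC => ->; rewrite ler_wpM2l //.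
  by rewrite leNgt ltr_cos ?in_itv /= -?leNgt //; lra.
have tE : t = (t / 2) *+ 2 by rewrite -[RHS]mulr_natr divfK.
rewrite {2}tE sin_mulr2n.
have h2 : 0 <= t / 2 <= pi / 2 by lra.
have h := sc _ h2.
have c2 : 1 <= cos (t / 2) ^+ 2 *+ 2.
  rewrite -subr_ge0 -cos_mulr2n -[(t / 2) *+ 2]mulr_natr divfK // cos_ge0_pihalf //; lra.
have c0 : 0 <= cos (t / 2) by apply: cos_ge0_pihalf; lra.
set c := cos (t / 2) in h c2 c0 *.
apply: le_trans (_ : (t / 2) * (c ^+ 2 *+ 2) <= _).
  by apply: ler_peMr => //; lra.
by rewrite expr2 -mulrnAr; nra.
Qed.

Definition unit_root (R : realType) (Q : nat) : R[i] := cis (2 * pi / Q%:R).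

Lemma unit_root_expn (R : realType) (Q : nat) : (0 < Q)%N -> unit_root R Q ^+ Q = 1.
Proof.
move=> Q0; rewrite cisX mulrC divfK ?pnatr_eq0 -?lt0n //.
by rewrite mulrC mulr_natr /cis cos2pi sin2pi.
Qed.

(** The distance from [1] to the [k]-th power of the root of unity, in units of [1/Q]. It plays the part
of the frequency: it is comparable to the distance from [k] to the nearest multiple of [Q]. *)
Definition chord (R : realType) (Q k : nat) : R := Q%:R * cmod (unit_root R Q ^+ k - 1).

Lemma chord_ge_min (R : realType) (Q k : nat) : (0 < k < Q)%N ->
  (minn k (Q - k))%:R <= chord R Q k.
Proof.
move=> /andP[k0 kQ].
have Q0 : (0 : R) < Q%:R by rewrite ltr0n; lia.
have pi2 := pi_ge2 R.
rewrite /chord /unit_root cisX.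
have -> : k%:R * (2 * pi / Q%:R) = (pi * (k%:R / Q%:R)) *+ 2 :> R by rewrite -mulr_natr; ring.
rewrite cmod_cis_sub1.
have key (x : R) : 0 <= x <= 1 / 2 -> x <= 2 * `|sin (pi * x)|.
  move=> /andP[x0 x1].
  have := @sin_ge_half R (pi * x); have -> : 0 <= pi * x <= pi / 2 by nra.
  move=> /(_ isT) h; have := ler_norm (sin (pi * x)); nra.
have half (m : nat) : (m <= Q - m)%N -> 0 <= (m%:R / Q%:R : R) <= 1 / 2.
  move=> mQ; apply/andP; split; first by rewrite divr_ge0 // ltW.
  rewrite ler_pdivrMr // mulrC mulrA mulr1 ler_pdivlMr // -natrM ler_nat; lia.
have kQR : (k%:R : R) < Q%:R by rewrite ltr_nat.
have k0R : (0 : R) < k%:R by rewrite ltr0n.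
rewrite -ler_pdivrMl //.
case: (leqP k (Q - k)) => hk; rewrite mulrC.
  exact/key/half.
have -> : sin (pi * (k%:R / Q%:R)) = sin (pi * ((Q - k)%:R / Q%:R)) :> R.
  rewrite natrB ?(ltnW kQ) // mulrBl divff ?gt_eqF // mulrBr mulr1.
  by rewrite [pi - _]addrC sinDpi sinN opprK.
by apply/key/half; lia.
Qed.

Lemma chord_ge1 (R : realType) (Q k : nat) : (0 < k < Q)%N -> 1 <= chord R Q k.
Proof.
move=> kQ; apply: le_trans (chord_ge_min R kQ); rewrite ler1n; lia.
Qed.

Lemma unit_root_prim (R : realType) (Q : nat) : (0 < Q)%N ->
  Q.-primitive_root (unit_root R Q).
Proof.
move=> Q0; apply/andP; split=> //; apply/forallP => i; rewrite unity_rootE.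
have [->|iQ] := eqVneq i.+1 Q; first by rewrite unit_root_expn // eqxx.
apply/eqP/negbTE/eqP => e.
have /(chord_ge1 R) : (0 < i.+1 < Q)%N by have := ltn_ord i; lia.
by rewrite /chord e subrr /cmod ComplexField.Normc.normc0 mulr0 ler10.
Qed.

Lemma cmod_sum_squares_le (R : realType) (Q k j : nat) (b : 'I_(2 ^ j) -> R[i]) (beta : R) :
  prime Q -> (0 < k < Q)%N -> (8 * (2 ^ j) ^ 2 <= Q)%N ->
  (forall i, cmod (b i) <= beta) ->
  \sum_(x < Q) cmod (\sum_i b i * unit_root R Q ^+ (k * (2 ^ j + i) ^ 2 * x)) ^+ 4 <=
  Q%:R * (beta ^+ 4 * (33 * j.+2 ^ 2 * (2 ^ j) ^ 2)%:R).
Proof.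
move=> pQ kQ LQ bB; rewrite -lecR.
have E4 (z : R[i]) : real_complex R (cmod z ^+ 4) = `|z| ^+ 4 by rewrite cmodE rmorphXn.
have -> : real_complex R (Q%:R * (beta ^+ 4 * (33 * j.+2 ^ 2 * (2 ^ j) ^ 2)%:R)) =
    Q%:R * real_complex R beta ^+ 4 * (33 * j.+2 ^ 2 * (2 ^ j) ^ 2)%:R.
  by rewrite 2!(rmorphM (real_complex R)) (rmorphXn (real_complex R)) !rmorph_nat mulrA.
rewrite (rmorph_sum (real_complex R)) (eq_bigr _ (fun x _ => E4 _)).
apply: (sum_norm4_squares_le pQ (unit_root_prim R (prime_gt0 pQ)) kQ LQ) => i.
by rewrite cmodE lecR.
Qed.

Lemma cmod_expr_sub1_le (R : realType) (z : R[i]) (n : nat) :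
  cmod z = 1 -> cmod (z ^+ n - 1) <= n%:R * cmod (z - 1).
Proof.
move=> z1; rewrite subrX1 cmodM mulrC ler_wpM2r ?cmod_ge0 //.
apply: le_trans (cmod_sum _ _ _) _.
under eq_bigr do rewrite cmodX z1 expr1n.
by rewrite sumr_const card_ord.
Qed.

(** * Variation and maximal inequalities *)

Lemma sum_over_blocks (V : zmodType) (p : nat -> nat) (h : nat -> V) (N : nat) :
  {homo p : m n / (m <= n)%N} ->
  \sum_(i < N) \sum_(p i <= x < p i.+1) h x = \sum_(p 0%N <= x < p N) h x.
Proof.
move=> p_homo; elim: N => [|N IHN]; first by rewrite big_ord0 big_geq.
by rewrite big_ord_recr IHN /= -big_cat_nat //= p_homo.
Qed.

Lemma cmod_sub_le_variation (R : realType) (F : nat -> R[i]) (a b u v : nat) :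
  (a <= u <= b)%N -> (a <= v <= b)%N ->
  cmod (F u - F v) <= \sum_(a <= x < b) cmod (F x.+1 - F x).
Proof.
wlog uv : u v / (v <= u)%N.
  move=> H uab vab; case/orP: (leq_total v u) => /H; first exact.
  by rewrite -opprB cmodN => /(_ vab uab).
move=> /andP[au ub] /andP[av vb].
rewrite -(telescope_sumr _ uv); apply: le_trans (cmod_sum _ _ _) _.
rewrite (@big_cat_nat _ _ _ v a b) //= (@big_cat_nat _ _ _ u v b) //=.
by rewrite addrCA lerDl addr_ge0 ?sumr_ge0 // => *; exact: cmod_ge0.
Qed.

(** A maximal inequality: [H u] exceeds each of the values [H x] by at most the total variation, hence
also exceeds their mean by no more than that. *)
Lemma le_mean_variation (R : realFieldType) (H e : nat -> R) (a b u : nat) :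
  (a < b)%N -> (a <= u <= b)%N -> (forall x, `|H x.+1 - H x| <= e x) ->
  H u <= (b - a)%:R^-1 * (\sum_(a <= x < b) H x) + \sum_(a <= x < b) e x.
Proof.
move=> ab /andP[au ub] He.
have e0 x : 0 <= e x by exact: le_trans (normr_ge0 _) (He x).
have var v : (a <= v < b)%N -> H u - H v <= \sum_(a <= x < b) e x.
  move=> /andP[av vb].
  have sub c d : (a <= c)%N -> (c <= d)%N -> (d <= b)%N ->
      \sum_(c <= x < d) e x <= \sum_(a <= x < b) e x.
    move=> ac cd db; rewrite (@big_cat_nat _ _ _ c a b) ?(leq_trans cd) //=.
    rewrite (@big_cat_nat _ _ _ d c b) //=.
    by rewrite addrCA lerDl addr_ge0 ?sumr_ge0.
  case/orP: (leq_total v u) => vu.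
    rewrite -(telescope_sumr _ vu); apply: le_trans (sub v u av vu ub).
    by apply: ler_sum => x _; apply: le_trans (ler_norm _) (He x).
  rewrite -opprB -(telescope_sumr _ vu) -sumrN; apply: le_trans (sub u v au vu (ltnW vb)).
  apply: ler_sum => x _; apply: le_trans (He x).
  by rewrite -normrN ler_norm.
have m0 : (0 : R) < (b - a)%:R by rewrite ltr0n subn_gt0.
rewrite -(ler_pM2l m0) mulrDr mulrA mulfV ?gt_eqF // mul1r.
rewrite -lerBlDl mulr_natl -sumr_const_nat mulr_natl -sumr_const_nat -sumrB.
by rewrite big_nat [X in _ <= X]big_nat; apply: ler_sum => v; exact: var.
Qed.

Lemma quartic_variation (R : realFieldType) (d x y : R) :
  0 <= d -> 0 <= x -> 0 <= y ->
  d * (x + y) * (x ^+ 2 + y ^+ 2) <= 4 * (d ^+ 4 + x ^+ 4 + y ^+ 4).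
Proof.
move=> d0 x0 y0.
pose m := Num.max d (Num.max x y).
have [dm xm ym] : [/\ d <= m, x <= m & y <= m] by rewrite /m !le_max !lexx !orbT.
have m0 : 0 <= m := le_trans d0 dm.
apply: le_trans (_ : m * (m + m) * (m ^+ 2 + m ^+ 2) <= _).
  by rewrite ler_pM ?mulr_ge0 ?addr_ge0 ?exprn_ge0 // ?ler_pM ?addr_ge0 // lerD // lerXn2r.
have -> : m * (m + m) * (m ^+ 2 + m ^+ 2) = 4 * m ^+ 4 by ring.
rewrite ler_pM2l //.
have [d4 x4 y4] : [/\ 0 <= d ^+ 4, 0 <= x ^+ 4 & 0 <= y ^+ 4] by rewrite !exprn_ge0.
rewrite /m; case: (leP d); case: (leP x) => _ _; lra.
Qed.

(** This replaces the inequality of Hoelder: summed over [x], it bounds a first power mean by a fourth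
power mean, and the best choice of [l] gives back the exponent [1/4]. *)
Lemma le_split4 (R : realFieldType) (l x : R) : 0 < l -> 0 <= x ->
  x <= l + x ^+ 4 / l ^+ 3.
Proof.
move=> l0 x0; have [xl|lx] := leP x l.
  by rewrite (le_trans xl) // lerDl divr_ge0 ?exprn_ge0 // ltW.
rewrite (@le_trans _ _ (x ^+ 4 / l ^+ 3)) ?lerDr ?(ltW l0) //.
rewrite ler_pdivlMr ?exprn_gt0 // [X in _ <= X]exprS ler_wpM2l // lerXn2r ?nnegrE //.
  exact: ltW.
exact: ltW.
Qed.

(** * Oscillation over the cells of a grid *)

(** The sample points [x/Q] in [[i/N, (i+1)/N]] are represented by the integers from [cell_start N Q i] to
[cell_start N Q i.+1], both included. Successive cells share an endpoint, so that the steps from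
[x] to [x.+1] are distributed over the cells without overlap. *)
Definition cell_start (N Q i : nat) : nat := ((i * Q) %/ N)%N.

Definition in_cell (N Q i u : nat) : bool :=
  (cell_start N Q i <= u <= cell_start N Q i.+1)%N.

Lemma cell_start_homo (N Q : nat) : {homo cell_start N Q : m n / (m <= n)%N}.
Proof. by move=> m n mn; rewrite leq_div2r // leq_mul2r mn orbT. Qed.

Lemma cell_start_last (N Q : nat) : (0 < N)%N -> cell_start N Q N = Q.
Proof. by move=> N0; rewrite /cell_start mulKn. Qed.

Lemma sum_cells (V : zmodType) (N Q : nat) (h : nat -> V) : (0 < N)%N ->
  \sum_(i < N) \sum_(cell_start N Q i <= x < cell_start N Q i.+1) h x = \sum_(x < Q) h x.
Proof.
move=> N0; rewrite sum_over_blocks; last exact: cell_start_homo.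
by rewrite cell_start_last // /cell_start mul0n div0n big_mkord.
Qed.

Lemma cell_size_ge (N Q i : nat) : (0 < N)%N -> (2 * N <= Q)%N ->
  (Q <= 2 * N * (cell_start N Q i.+1 - cell_start N Q i))%N.
Proof.
move=> N0 NQ; rewrite /cell_start.
have h1 := ltn_ceil (i.+1 * Q) N0; have h2 := leq_divM (i * Q) N.
move: h1 h2; rewrite mulSn; move: ((Q + _) %/ N)%N (i * Q %/ N)%N => a b h1 h2.
have : (Q < (a - b).+1 * N)%N by nia.
move: (a - b)%N => d hd; nia.
Qed.

(** The factor [tau] normalizes the increments of [F]: it is to be chosen such that [F] and [D] satisfy
the same fourth power bound. *)
Section Cells.
Variables (R : realType) (N Q : nat) (F : nat -> R[i]) (D : nat -> R) (tau S : R).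
Hypotheses (N0 : (0 < N)%N) (NQ : (2 * N <= Q)%N) (tau0 : 0 <= tau).
Hypothesis D0 : forall x, 0 <= D x.
Hypothesis FD : forall x, cmod (F x.+1 - F x) <= tau * D x.
Hypothesis D4 : \sum_(x < Q) D x ^+ 4 <= Q%:R * S.
Hypothesis F4 : \sum_(x < Q) cmod (F x) ^+ 4 <= Q%:R * S.
Hypothesis F4' : \sum_(x < Q) cmod (F x.+1) ^+ 4 <= Q%:R * S.

(** The oscillation over a cell is at most the variation over it. This is efficient when [F] varies
little over a cell. *)
Lemma sum_cell_osc_le (u v : nat -> nat) (a : R) : 0 < a ->
  (forall i, in_cell N Q i (u i)) -> (forall i, in_cell N Q i (v i)) ->
  \sum_(i < N) cmod (F (u i) - F (v i)) <= tau * Q%:R * (a + S / a ^+ 3).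
Proof.
move=> a0 uP vP.
apply: le_trans (_ : \sum_(i < N) \sum_(cell_start N Q i <= x < cell_start N Q i.+1)
    tau * D x <= _).
  apply: ler_sum => i _.
  apply: le_trans (cmod_sub_le_variation F (uP i) (vP i)) _.
  by apply: ler_sum => x _; exact: FD.
rewrite sum_cells // -mulr_sumr -mulrA ler_wpM2l //.
apply: le_trans (_ : \sum_(x < Q) (a + D x ^+ 4 / a ^+ 3) <= _).
  by apply: ler_sum => x _; exact: le_split4.
rewrite big_split /= sumr_const card_ord -[a *+ Q]mulr_natl mulrDr lerD2l.
by rewrite -mulr_suml mulrA ler_pM2r ?invr_gt0 ?exprn_gt0.
Qed.

Lemma quartic_increment_le (x : nat) :
  `|cmod (F x.+1) ^+ 4 - cmod (F x) ^+ 4| <=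
  tau * (4 * (D x ^+ 4 + cmod (F x.+1) ^+ 4 + cmod (F x) ^+ 4)).
Proof.
have := cmod_ge0 (F x); have := cmod_ge0 (F x.+1); have := FD x.
have h1 := cmodB (F x.+1) (F x.+1 - F x); have h2 := cmodD (F x.+1 - F x) (F x).
move: h1 h2; rewrite subKr subrK.
move: (cmod (F x.+1)) (cmod (F x)) (cmod (F x.+1 - F x)) => s t e h1 h2 eD s0 t0.
have -> : s ^+ 4 - t ^+ 4 = (s - t) * (s + t) * (s ^+ 2 + t ^+ 2) by ring.
rewrite !normrM (ger0_norm (_ : 0 <= s + t)) ?addr_ge0 //.
rewrite (ger0_norm (_ : 0 <= s ^+ 2 + t ^+ 2)) ?addr_ge0 ?sqr_ge0 //.
apply: le_trans (_ : tau * (D x * (s + t) * (s ^+ 2 + t ^+ 2)) <= _).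
  rewrite !mulrA !ler_wpM2r ?addr_ge0 ?sqr_ge0 //.
  by apply: le_trans eD; rewrite ler_norml; apply/andP; split; lra.
by rewrite ler_wpM2l // quartic_variation.
Qed.

(** The maximal inequality for [|F|^4]. This is efficient when [F] oscillates within the cells. *)
Lemma sum_cell_pow4_le (u : nat -> nat) : (forall i, in_cell N Q i (u i)) ->
  \sum_(i < N) cmod (F (u i)) ^+ 4 <= (2 * N%:R + 12 * (tau * Q%:R)) * S.
Proof.
move=> uP.
have Q0 : (0 : R) < Q%:R by rewrite ltr0n; lia.
have NR : (0 : R) < N%:R by rewrite ltr0n.
pose e x := tau * (4 * (D x ^+ 4 + cmod (F x.+1) ^+ 4 + cmod (F x) ^+ 4)).
apply: le_trans (_ : \sum_(i < N) (2 * N%:R / Q%:R *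
    (\sum_(cell_start N Q i <= x < cell_start N Q i.+1) cmod (F x) ^+ 4) +
    \sum_(cell_start N Q i <= x < cell_start N Q i.+1) e x) <= _).
  apply: ler_sum => i _.
  have size_ge := cell_size_ge i N0 NQ.
  have ab : (cell_start N Q i < cell_start N Q i.+1)%N.
    rewrite -subn_gt0 lt0n; apply/eqP => h; move: size_ge; rewrite h; lia.
  apply: le_trans (le_mean_variation ab (uP i) quartic_increment_le) _.
  rewrite lerD2r ler_wpM2r ?sumr_ge0 // => [x _|]; first by rewrite exprn_ge0 ?cmod_ge0.
  have d0 : (0 : R) < (cell_start N Q i.+1 - cell_start N Q i)%:R by rewrite ltr0n subn_gt0.
  rewrite -[leLHS]mul1r ler_pdivrMr // mulrAC ler_pdivlMr // mul1r.
  by rewrite -!natrM ler_nat.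
rewrite big_split /= -mulr_sumr !sum_cells //.
have -> : (2 * N%:R + 12 * (tau * Q%:R)) * S =
  2 * N%:R / Q%:R * (Q%:R * S) + tau * (4 * (Q%:R * S + Q%:R * S + Q%:R * S)).
  by field; rewrite gt_eqF.
apply: lerD; first by rewrite ler_wpM2l ?divr_ge0 ?mulr_ge0 // ltW.
rewrite /e -mulr_sumr ler_wpM2l // -mulr_sumr ler_wpM2l // !big_split /=.
by rewrite !lerD.
Qed.

End Cells.

Lemma ln_le_sq (R : realType) (s L N : R) : 0 < s -> 0 < L -> 0 < N ->
  (s * L ^+ 2 <= N) = (ln s + ln L *+ 2 <= ln N).
Proof.
move=> s0 L0 N0; have L2 : 0 < L ^+ 2 by rewrite exprn_gt0.
by rewrite -lnXn // -lnM ?posrE // ler_ln ?posrE ?mulr_gt0.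
Qed.

(** In terms of the logarithms of [s], [L] and [N] this is linear: it is [3/4 - delta/2] times the last
hypothesis plus [(1 - delta)/2] times [0 <= ln s]. *)
Lemma smooth_range_bound (R : realType) (delta s L N : R) : 0 < delta <= 1 ->
  1 <= s -> 1 <= L -> 1 <= N -> s * L ^+ 2 <= N ->
  L ^+ 2 * s * L `^ (- (1 / 2) - delta) <= N * (s `^ (3 / 4) * N `^ (- (1 / 4) - delta / 2)).
Proof.
move=> /andP[d0 d1] s1 L1 N1.
have [s0 L0 N0] : [/\ 0 < s, 0 < L & 0 < N] by split; lra.
rewrite ln_le_sq // => h.
rewrite -ler_ln ?posrE ?mulr_gt0 ?powR_gt0 ?exprn_gt0 //.
rewrite !lnM ?posrE ?mulr_gt0 ?powR_gt0 ?exprn_gt0 // !ln_powR ?lnXn //.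
have [ls lL lN] : [/\ 0 <= ln s, 0 <= ln L & 0 <= ln N] by rewrite !ln_ge0.
move: (ln s) (ln L) (ln N) h ls lL lN => x y z h x0 y0 z0.
have h2 : 0 <= (3 / 4 - delta / 2) * (z - x - y *+ 2) by rewrite mulr_ge0; lra.
have h3 : 0 <= (1 - delta) * x by rewrite mulr_ge0; lra.
nra.
Qed.

(** In terms of logarithms, [2 delta] times the last hypothesis plus [2 (1 - delta)] times [0 <= ln s]. *)
Lemma rough_range_bound (R : realType) (delta s L N : R) : 0 < delta <= 1 ->
  1 <= s -> 1 <= L -> 1 <= N -> N <= s * L ^+ 2 ->
  s * L ^+ 2 * (L `^ (- (1 / 2) - delta)) ^+ 4 <=
  N * (s `^ (3 / 4) * N `^ (- (1 / 4) - delta / 2)) ^+ 4.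
Proof.
move=> /andP[d0 d1] s1 L1 N1 h.
have [s0 L0 N0] : [/\ 0 < s, 0 < L & 0 < N] by split; lra.
have {}h : ln N <= ln s + ln L *+ 2.
  have L2 : 0 < L ^+ 2 by rewrite exprn_gt0.
  by rewrite -lnXn // -lnM ?posrE // ler_ln ?posrE ?mulr_gt0.
rewrite -ler_ln ?posrE ?mulr_gt0 ?exprn_gt0 ?mulr_gt0 ?powR_gt0 ?exprn_gt0 //.
rewrite !lnM ?posrE ?mulr_gt0 ?exprn_gt0 ?mulr_gt0 ?powR_gt0 ?exprn_gt0 //.
rewrite ?lnXn ?mulr_gt0 ?powR_gt0 // ?lnM ?posrE ?powR_gt0 // !ln_powR.
have [ls lL lN] : [/\ 0 <= ln s, 0 <= ln L & 0 <= ln N] by rewrite !ln_ge0.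
move: (ln s) (ln L) (ln N) h ls lL lN => x y z h x0 y0 z0.
have h2 : 0 <= delta * (x + y *+ 2 - z) by rewrite mulr_ge0; lra.
have h3 : 0 <= (1 - delta) * x by rewrite mulr_ge0; lra.
nra.
Qed.

(** * Oscillation of one frequency of one dyadic block *)

Definition coef {R : realType} (delta : R) (n : nat) : R := (n%:R `^ (1 + delta))^-1.

(** The contribution of the frequency [k] to the block [2^j <= n < 2^(j+1)], at the point [x/Q]. *)
Definition block_sum {R : realType} (delta : R) (Q k j x : nat) : R[i] :=
  \sum_(i < 2 ^ j) real_complex R (coef delta (2 ^ j + i)) *
    unit_root R Q ^+ (k * (2 ^ j + i) ^ 2 * x).

Lemma coef_ge0 (R : realType) (delta : R) n : 0 <= coef delta n.
Proof. by rewrite invr_ge0 powR_ge0. Qed.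

Lemma coef_le (R : realType) (delta : R) (L n : nat) : 0 < delta -> (0 < L <= n)%N ->
  coef delta n <= L%:R `^ (- (1 + delta)).
Proof.
move=> d0 /andP[L0 Ln]; rewrite powRN lef_pV2 ?posrE ?powR_gt0 ?ltr0n //; last lia.
by apply: ge0_ler_powR; rewrite ?nnegrE ?ler_nat //; lra.
Qed.

Lemma pow4_scale (R : realType) (delta L : R) : 0 < L ->
  (L `^ (- (1 + delta))) ^+ 4 * L ^+ 2 = (L `^ (- (1 / 2) - delta)) ^+ 4.
Proof.
move=> L0; rewrite -!powR_mulrn ?powR_ge0 ?(ltW L0) // -!powRrM -powRD; last first.
  by apply/implyP => _; rewrite gt_eqF.
congr (_ `^ _); by field.
Qed.

(** The two bounds of the preceding part, with [s = chord Q k], [L = 2 ^ j] and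
[a = L^(-1/2-delta)]: the variation is used when [s L^2 <= N] and the maximal inequality otherwise.
Both give the same power of [N]; the power of [s] is what matters for the summation over [k]. *)
Lemma block_sum_osc_le (R : realType) (delta : R) (N Q k j : nat) (u v : nat -> nat) :
  0 < delta <= 1 -> (0 < N)%N -> (2 * N <= Q)%N -> prime Q -> (0 < k < Q)%N ->
  (8 * (2 ^ j) ^ 2 <= Q)%N ->
  (forall i, in_cell N Q i (u i)) -> (forall i, in_cell N Q i (v i)) ->
  \sum_(i < N) cmod (block_sum delta Q k j (u i) - block_sum delta Q k j (v i)) <=
  102 * (33 * j.+2 ^ 2)%:R *
    (N%:R * (chord R Q k `^ (3 / 4) * N%:R `^ (- (1 / 4) - delta / 2))).
Proof.
move=> d01 N0 NQ pQ kQ LQ uP vP; have /andP[d0 d1] := d01.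
set L := (2 ^ j)%N; set H := (33 * _)%:R; set s := chord R Q k.
set LR : R := L%:R.
have L0 : (0 < L)%N by rewrite expn_gt0.
have LR1 : 1 <= LR by rewrite ler1n.
have NR1 : 1 <= N%:R :> R by rewrite ler1n.
have s1 : 1 <= s by exact: chord_ge1.
have H1 : 1 <= H by rewrite ler1n muln_gt0 expn_gt0.
have Q0 : (0 : R) < Q%:R by rewrite ltr0n prime_gt0.
pose w := unit_root R Q.
have w1 : cmod w = 1.
  apply: complexI; rewrite -cmodE.
  exact: (norm_expr_root1 (prime_gt0 pQ) (unit_root_expn R (prime_gt0 pQ))).
(* The squares [n ^ 2] with [n] in the block are at most [4 * LR ^ 2]. *)
pose tau := 4 * LR ^+ 2 * cmod (w ^+ k - 1).
have sE : Q%:R * tau = 4 * LR ^+ 2 * s by rewrite /tau /s /chord; ring.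
have tau0 : 0 < tau.
  rewrite -(pmulr_rgt0 _ Q0) sE; apply: mulr_gt0; last exact: lt_le_trans s1.
  by rewrite mulr_gt0 // exprn_gt0 // (lt_le_trans ltr01).
pose b (i : 'I_L) := real_complex R (coef delta (L + i)).
pose beta := LR `^ (- (1 + delta)).
have bB i : cmod (b i) <= beta.
  by rewrite cmod_real ger0_norm ?coef_ge0 // coef_le // L0 leq_addr.
pose nu (i : 'I_L) := (k * (L + i) ^ 2)%N.
pose F := block_sum delta Q k j.
pose D x := cmod (\sum_i b i * ((w ^+ nu i - 1) / real_complex R tau) * w ^+ (nu i * x)).
pose a := LR `^ (- (1 / 2) - delta).
have a0 : 0 < a by rewrite powR_gt0 // ltr0n.
have SE : beta ^+ 4 * (33 * j.+2 ^ 2 * (2 ^ j) ^ 2)%:R = H * a ^+ 4.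
  by rewrite natrM mulrCA natrX pow4_scale // ltr0n.
have l4 := @cmod_sum_squares_le R Q k j.
have F4 : \sum_(x < Q) cmod (F x) ^+ 4 <= Q%:R * (H * a ^+ 4).
  by rewrite -SE; exact: l4.
have F4' : \sum_(x < Q) cmod (F x.+1) ^+ 4 <= Q%:R * (H * a ^+ 4).
  rewrite -SE; have := l4 (fun i => b i * w ^+ nu i) beta pQ kQ LQ.
  have c1 i : cmod (b i * w ^+ nu i) <= beta by rewrite cmodM cmodX w1 expr1n mulr1.
  move=> /(_ c1); congr (_ <= _); apply: eq_bigr => x _; congr (cmod _ ^+ 4).
  by apply: eq_bigr => i _; rewrite mulnS exprD mulrA.
have D4 : \sum_(x < Q) D x ^+ 4 <= Q%:R * (H * a ^+ 4).
  rewrite -SE; apply: l4 => // i; rewrite !cmodM -[leRHS]mulr1 ler_pM ?mulr_ge0 ?cmod_ge0 //.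
  have -> : cmod (real_complex R tau)^-1 = tau^-1.
    by rewrite -fmorphV cmod_real ger0_norm // invr_ge0 ltW.
  rewrite ler_pdivrMr // mul1r /nu exprM.
  apply: le_trans (cmod_expr_sub1_le _ _) _; first by rewrite cmodX w1 expr1n.
  rewrite /tau ler_wpM2r ?cmod_ge0 // /LR -natrX -natrM ler_nat.
  by rewrite -[4%N]/(2 ^ 2)%N -expnMn leq_sqr mul2n -addnn leq_add2l ltnW.
have FD x : cmod (F x.+1 - F x) <= tau * D x.
  rewrite /D -[tau in tau * _]ger0_norm ?(ltW tau0) // -cmod_real -cmodM mulr_sumr -sumrB.
  rewrite le_eqVlt; apply/orP; left; apply/eqP; congr cmod; apply: eq_bigr => i _.
  have t0 : real_complex R tau != 0 by rewrite fmorph_eq0 gt_eqF.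
  rewrite -/w -/L -/(nu i) mulnS exprD -/(b i) [X in _ = X](_ : _ =
     (real_complex R tau / real_complex R tau) * (b i * (w ^+ nu i - 1) * w ^+ (nu i * x))).
    by rewrite mulfV // mul1r; ring.
  by ring.
have D0 x : 0 <= D x by exact: cmod_ge0.
pose Lam := s `^ (3 / 4) * N%:R `^ (- (1 / 4) - delta / 2).
have Lam0 : 0 < Lam by rewrite mulr_gt0 ?powR_gt0 //; lra.
have oscA := sum_cell_osc_le N0 (ltW tau0) D0 FD D4 a0 uP vP.
have supB := sum_cell_pow4_le N0 NQ (ltW tau0) D0 FD D4 F4 F4'.
rewrite -/F -/Lam; have NR0 : (0 : R) < N%:R by lra.
have s0 : 0 < s := lt_le_trans ltr01 s1.
have LR0 : 0 < LR := lt_le_trans ltr01 LR1.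
have H0 : 0 < H := lt_le_trans ltr01 H1.
have HN0 : 0 <= H * (N%:R * Lam) by rewrite ltW // mulr_gt0 // mulr_gt0.
have [smooth|/ltW rough] := leP (s * LR ^+ 2) N%:R.
- apply: le_trans oscA _; rewrite mulrC [tau * _]mulrC sE.
  have -> : H * a ^+ 4 / a ^+ 3 = H * a by field; rewrite gt_eqF.
  have := smooth_range_bound d01 s1 LR1 NR1 smooth.
  rewrite -/Lam -/a => le1.
  have LL0 : 0 <= LR ^+ 2 * s * a by rewrite ltW // mulr_gt0 // mulr_gt0 // exprn_gt0.
  apply: le_trans (_ : 8 * (H * (LR ^+ 2 * s * a)) <= _).
    rewrite (_ : (a + H * a) * _ = 4 * (1 + H) * (LR ^+ 2 * s * a)); last by ring.
    by rewrite [leRHS]mulrA ler_wpM2r //; lra.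
  have : H * (LR ^+ 2 * s * a) <= H * (N%:R * Lam) by rewrite ler_wpM2l // ltW.
  rewrite -[102 * H * _]mulrA; move: HN0.
  by move: (H * (N%:R * Lam)) (H * (LR ^+ 2 * s * a)) => x y; lra.
- have := rough_range_bound d01 s1 LR1 NR1 rough; rewrite -/a -/Lam => le4.
  have sup (z : nat -> nat) : (forall i, in_cell N Q i (z i)) ->
      \sum_(i < N) cmod (F (z i)) <= 51 * (H * (N%:R * Lam)).
    move=> zP; apply: le_trans (_ : \sum_(i < N) (Lam + cmod (F (z i)) ^+ 4 / Lam ^+ 3) <= _).
      by apply: ler_sum => i _; rewrite le_split4 ?cmod_ge0.
    rewrite big_split /= sumr_const card_ord -mulr_suml -[Lam *+ N]mulr_natl.
    apply: le_trans (_ : N%:R * Lam + 50 * (H * (N%:R * Lam)) <= _).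
      rewrite lerD2l ler_pdivrMr ?exprn_gt0 //; apply: le_trans (supB z zP) _.
      rewrite [tau * _]mulrC sE.
      apply: le_trans (_ : 50 * (H * (s * LR ^+ 2 * a ^+ 4)) <= _).
        rewrite (_ : 50 * _ = 50 * (s * LR ^+ 2) * (H * a ^+ 4)); last by ring.
        rewrite ler_wpM2r ?mulr_ge0 ?exprn_ge0 ?(ltW a0) ?(ltW H0) //.
        rewrite (_ : 12 * _ = 48 * (s * LR ^+ 2)); last by ring.
        lra.
      rewrite (_ : 50 * (H * (N%:R * Lam)) * Lam ^+ 3 = 50 * (H * (N%:R * Lam ^+ 4))); last by ring.
      by rewrite ler_wpM2l // ler_wpM2l // (ltW H0).
    have : N%:R * Lam <= H * (N%:R * Lam) by rewrite ler_peMl // mulr_ge0 // ltW.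
    lra.
  apply: le_trans (_ : \sum_(i < N) (cmod (F (u i)) + cmod (F (v i))) <= _).
    by apply: ler_sum => i _; exact: cmodB.
  rewrite big_split /=; have := sup u uP; have := sup v vP; lra.
Qed.

(** * Summation over the frequencies *)

(** With [n^(-a) = (n+1)^(-a) exp(a ln((n+1)/n))], this follows from [exp u >= 1 + u] and
[- ln(1 - 1/(n+1)) >= 1/(n+1)]. *)
Lemma powR_telescope (R : realType) (a : R) (n : nat) : 0 < a -> (0 < n)%N ->
  a * n.+1%:R `^ (- (1 + a)) <= n%:R `^ (- a) - n.+1%:R `^ (- a).
Proof.
move=> a0 n0.
have nR : (0 : R) < n%:R by rewrite ltr0n.
have mR : (0 : R) < n.+1%:R by rewrite ltr0n.
have -> : n%:R `^ (- a) = n.+1%:R `^ (- a) * expR (a * (ln n.+1%:R - ln n%:R)) :> R.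
  by rewrite /powR !gt_eqF // -expRD; congr expR; ring.
have -> : n.+1%:R `^ (- (1 + a)) = n.+1%:R `^ (- a) / n.+1%:R :> R.
  rewrite -[X in _ = _ * X]powR_inv1 ?(ltW mR) // -powRD; last by apply/implyP => _; rewrite gt_eqF.
  by congr (_ `^ _); ring.
rewrite lerBrDr mulrA [a * _]mulrC -mulrA -[X in _ + X]mulr1 -mulrDr.
rewrite ler_pM2l ?powR_gt0 //.
apply: le_trans (expR_ge1Dx _); rewrite addrC lerD2l ler_pM2l //.
rewrite -ln_div ?posrE // -[leLHS]opprK lerNl -lnV ?posrE ?divr_gt0 // invf_div.
have -> : n%:R / n.+1%:R = 1 + (- n.+1%:R^-1) :> R.
  by rewrite -natr1; field; rewrite natr1 gt_eqF.
apply: le_ln1Dx.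
by rewrite ltrN2 invf_lt1 // ltr1n.
Qed.

Lemma sum_powR_tail_le (R : realType) (a : R) (m M : nat) : 0 < a -> (0 < m)%N ->
  \sum_(m <= n < M) n.+1%:R `^ (- (1 + a)) <= m%:R `^ (- a) / a.
Proof.
move=> a0 m0; have [mM|Mm] := leqP m M; last first.
  by rewrite big_geq ?(ltnW Mm) // divr_ge0 ?powR_ge0 // ltW.
rewrite ler_pdivlMr // mulr_suml.
apply: le_trans (_ : \sum_(m <= n < M) (- (n.+1%:R `^ (- a)) - - (n%:R `^ (- a))) <= _).
  rewrite big_nat [leRHS]big_nat; apply: ler_sum => n /andP[mn _].
  by rewrite opprK [leRHS]addrC mulrC powR_telescope // (leq_trans m0).
by rewrite telescope_sumr // opprK gerDr oppr_le0 powR_ge0.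
Qed.

Lemma sum_powR_5_4_le (R : realType) (Q : nat) :
  \sum_(1 <= k < Q) k%:R `^ (- (5 / 4)) <= 5 :> R.
Proof.
case: Q => [|[|Q]]; [by rewrite big_geq | by rewrite big_geq | ].
rewrite big_ltn // powR1 big_add1 /=.
have := @sum_powR_tail_le R (1 / 4) 1 Q.+1; rewrite powR1 => /(_ _ isT) h.
have -> : - (5 / 4) = - (1 + 1 / 4) :> R by field.
have := h ltac:(by []).
have -> : 1 / (1 / 4) = 4 :> R by field.
lra.
Qed.

Lemma sum_chord_le (R : realType) (Q : nat) :
  \sum_(1 <= k < Q) chord R Q k `^ (- (5 / 4)) <= 10.
Proof.
apply: le_trans (_ : \sum_(1 <= k < Q) (k%:R `^ (- (5 / 4)) + (Q - k)%:R `^ (- (5 / 4))) <= _).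
  rewrite big_nat [leRHS]big_nat; apply: ler_sum => k kQ.
  have c0 : 0 < chord R Q k := lt_le_trans ltr01 (chord_ge1 R kQ).
  have mono (m : nat) : (0 < m)%N -> m%:R <= chord R Q k ->
     chord R Q k `^ (- (5 / 4)) <= m%:R `^ (- (5 / 4)).
    move=> m0 mc; rewrite !powRN lef_pV2 ?posrE ?powR_gt0 ?ltr0n //.
    by apply: ge0_ler_powR; rewrite ?nnegrE ?(ltW c0).
  have := chord_ge_min R kQ.
  case: (leqP k (Q - k)) => _ /mono h.
    by rewrite (le_trans (h _)) ?lerDl ?powR_ge0 //; lia.
  by rewrite (le_trans (h _)) ?lerDr ?powR_ge0 //; lia.
rewrite big_split /= [X in _ + X]big_nat_rev /=.
have -> : \sum_(1 <= i < Q) (Q - (1 + Q - i.+1))%:R `^ (- (5 / 4)) =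
          \sum_(1 <= k < Q) k%:R `^ (- (5 / 4)) :> R.
  by rewrite big_nat [RHS]big_nat; apply: eq_bigr => k kQ; congr (_%:R `^ _); lia.
have := @sum_powR_5_4_le R Q; lra.
Qed.

(** The block [2^j <= n < 2^(j+1)] of the series at [x/Q], where [f m] stands for [g (m/Q)]. *)
Definition sampled_block {R : realType} (delta : R) (f : nat -> R) (j x : nat) : R :=
  \sum_(i < 2 ^ j) f ((2 ^ j + i) ^ 2 * x)%N * coef delta (2 ^ j + i).

(** The Fourier coefficients are [O(s^-2)] with [s = chord Q k], and the frequency [k] costs [s^(3/4)];
the sum of [s^(-5/4)] is bounded independently of [Q]. *)
Lemma sampled_block_osc_le (R : realType) (delta K : R) (f : nat -> R) (N Q j : nat)
    (u v : nat -> nat) :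
  0 < delta <= 1 -> (0 < N)%N -> (2 * N <= Q)%N -> prime Q ->
  (8 * (2 ^ j) ^ 2 <= Q)%N ->
  (forall m, f (m + Q)%N = f m) ->
  (forall m, `|f m.+2 - f m.+1 *+ 2 + f m| <= K / Q%:R ^+ 2) ->
  (forall i, in_cell N Q i (u i)) -> (forall i, in_cell N Q i (v i)) ->
  \sum_(i < N) `|sampled_block delta f j (u i) - sampled_block delta f j (v i)| <=
  1020 * K * (33 * j.+2 ^ 2)%:R * (N%:R * N%:R `^ (- (1 / 4) - delta / 2)).
Proof.
move=> d01 N0 NQ pQ LQ fQ fK uP vP.
have Qpos := prime_gt0 pQ.
have Q0 : (0 : R) < Q%:R by rewrite ltr0n.
set w := unit_root R Q.
have [c [fc cK]] : exists c : nat -> R[i],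
    (forall m, real_complex R (f m) = \sum_(k < Q) c k * w ^+ (k * m)) /\
    (forall k, `|c k| * `|w ^+ k - 1| ^+ 2 <= real_complex R (K / Q%:R ^+ 2)).
  apply: dft_exists (unit_root_prim R Qpos) _ _ => m; first by rewrite fQ.
  by rewrite -rmorphMn -rmorphB -rmorphD /= cmodE cmod_real lecR.
have cK' k : (0 < k < Q)%N -> cmod (c k) <= K / chord R Q k ^+ 2.
  move=> kQ; have c0 : 0 < chord R Q k := lt_le_trans ltr01 (chord_ge1 R kQ).
  rewrite ler_pdivlMr ?exprn_gt0 // /chord exprMn mulrCA mulrC -ler_pdivlMr ?exprn_gt0 //.
  by have := cK k; rewrite !cmodE -rmorphXn -rmorphM lecR.
have decomp x : real_complex R (sampled_block delta f j x) =
    \sum_(k < Q) c k * block_sum delta Q k j x.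
  rewrite /sampled_block rmorph_sum /=.
  rewrite (eq_bigr (fun i : 'I_(2 ^ j) => \sum_(k < Q) c k *
      (real_complex R (coef delta (2 ^ j + i)) * w ^+ (k * (2 ^ j + i) ^ 2 * x)))).
    by rewrite exchange_big; apply: eq_bigr => k _; rewrite mulr_sumr.
  move=> i _; rewrite (rmorphM (real_complex R)) /= fc mulr_suml; apply: eq_bigr => k _.
  by rewrite mulnA; ring.
pose E := 102 * (33 * j.+2 ^ 2)%:R * (N%:R * N%:R `^ (- (1 / 4) - delta / 2)) : R.
have E0 : 0 <= E by rewrite !mulr_ge0 ?powR_ge0.
apply: le_trans (_ : \sum_(i < N) \sum_(1 <= k < Q) cmod (c k) *
    cmod (block_sum delta Q k j (u i) - block_sum delta Q k j (v i)) <= _).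
  apply: ler_sum => i _.
  rewrite -cmod_real.
  have -> (y z : R) : real_complex R (y - z) = real_complex R y - real_complex R z.
    by rewrite rmorphB.
  rewrite !decomp -sumrB.
  rewrite -(big_mkord predT (fun k => c k * block_sum delta Q k j (u i)
                              - c k * block_sum delta Q k j (v i))).
  rewrite big_ltn // [X in X + _](_ : _ = 0) ?add0r; last first.
    suff -> : block_sum delta Q 0 j (u i) = block_sum delta Q 0 j (v i) by rewrite subrr.
    by apply: eq_bigr => n _; rewrite !mul0n.
  apply: le_trans (cmod_sum _ _ _) _.
  by apply: ler_sum => k _; rewrite -mulrBr cmodM.
rewrite exchange_big /=.
apply: le_trans (_ : \sum_(1 <= k < Q) K * E * chord R Q k `^ (- (5 / 4)) <= _).
  rewrite big_nat [leRHS]big_nat; apply: ler_sum => k kQ; rewrite -mulr_sumr.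
  have c0 : 0 < chord R Q k := lt_le_trans ltr01 (chord_ge1 R kQ).
  have := block_sum_osc_le d01 N0 NQ pQ kQ LQ uP vP.
  move=> /(ler_pM (cmod_ge0 (c k)) _ (cK' k kQ)) h.
  apply: le_trans (h _) _; first by apply: sumr_ge0 => i _; exact: cmod_ge0.
  have -> : chord R Q k `^ (3 / 4) = chord R Q k ^+ 2 * chord R Q k `^ (- (5 / 4)).
    rewrite -powR_mulrn ?(ltW c0) // -powRD; last by apply/implyP => _; rewrite gt_eqF.
    by congr (_ `^ _); field.
  rewrite /E le_eqVlt; apply/orP; left; apply/eqP; field.
  by rewrite gt_eqF.
have K0 : 0 <= K.
  by have := le_trans (normr_ge0 _) (fK 0%N); rewrite pmulr_lge0 // invr_gt0 exprn_gt0.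
rewrite -mulr_sumr; apply: le_trans (_ : K * E * 10 <= _).
  by rewrite ler_wpM2l ?sum_chord_le // mulr_ge0.
by rewrite /E le_eqVlt; apply/orP; left; apply/eqP; ring.
Qed.

(** * The generating function and the tail of the series *)

(** The hypothesis concerns all sufficiently large constants; one of them is enough. *)
Lemma lipschitz_bound (R : realType) (f : R -> R) : lipschitz f ->
  exists2 K : R, 0 < K & forall x y, `|f x - f y| <= K * `|x - y|.
Proof.
move=> [M [_ MP]].
exists (Num.max M 0 + 1); first by rewrite ltr_wpDl // le_max lexx orbT.
move=> x y; apply: (MP (Num.max M 0 + 1) _ (x, y)) => //.
by rewrite ltr_pwDr // le_max lexx.
Qed.

Lemma mean_value (R : realType) (g : R -> R) (a b : R) : (forall x, derivable g x 1) ->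
  a <= b -> exists2 c, a <= c <= b & g b - g a = derive1 g c * (b - a).
Proof.
move=> dg ab.
have der x : x \in `]a, b[ -> is_derive x 1 g (derive1 g x).
  by move=> _; rewrite derive1E; exact: derivableP.
have cont : {within `[a, b], continuous g} by apply: derivable_within_continuous => x _.
by have [c cab e] := MVT_segment ab der cont; exists c.
Qed.

Section Generator.
Variables (R : realType) (g : R -> R) (K : R).
Hypotheses (g_per : periodic g 1) (dg : forall x : R, derivable g x 1) (K0 : 0 < K).
Hypothesis g'_lip : forall x y, `|derive1 g x - derive1 g y| <= K * `|x - y|.

Lemma second_difference_le (x h : R) : 0 <= h ->
  `|g (x + h + h) - g (x + h) *+ 2 + g x| <= 2 * K * h ^+ 2.
Proof.
move=> h0.
have [|c1 c1P e1] := @mean_value R g x (x + h) dg; first by rewrite lerDl.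
have [|c2 c2P e2] := @mean_value R g (x + h) (x + h + h) dg; first by rewrite lerDl.
have -> : g (x + h + h) - g (x + h) *+ 2 + g x =
   (g (x + h + h) - g (x + h)) - (g (x + h) - g x) by ring.
rewrite e1 e2 (_ : _ - _ = (derive1 g c2 - derive1 g c1) * h); last by ring.
rewrite normrM (ger0_norm h0).
have : `|c2 - c1| <= 2 * h by rewrite ler_norml; lra.
move=> /(ler_wpM2l (ltW K0)) /(le_trans (g'_lip c2 c1)) /(ler_wpM2r h0) H.
by apply: le_trans H _; rewrite le_eqVlt; apply/orP; left; apply/eqP; ring.
Qed.

(** By Rolle's theorem [g'] vanishes within distance one of any point, so it is bounded by its
Lipschitz constant. *)
Lemma generator_lipschitz (x y : R) : `|g x - g y| <= K * `|x - y|.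
Proof.
have g'_le z : `|derive1 g z| <= K.
  have [|c cP] := @mean_value R g z (z + 1) dg; first by rewrite lerDl.
  rewrite g_per subrr addrAC subrr add0r mulr1 => /esym e.
  rewrite -[derive1 g z]subr0 -e; apply: le_trans (g'_lip _ _) _.
  by rewrite ler_piMr ?(ltW K0) // ler_norml; lra.
wlog xy : x y / y <= x.
  by move=> H; case: (leP y x) => [/H//|/ltW /H]; rewrite distrC [`|y - x|]distrC.
have [c cP ->] := mean_value dg xy.
by rewrite normrM ler_wpM2r.
Qed.

Lemma generator_bounded : exists2 B : R, 0 < B & forall x, 0 <= x -> `|g x| <= B.
Proof.
exists (`|g 0| + K); first by rewrite ltr_wpDl.
move=> x x0; have /andP[tx xt] := truncn_itv x0.
set n := Num.trunc x in tx xt.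
have -> : g x = g (x - n%:R).
  by rewrite -[in LHS](subrK n%:R x) periodicn.
rewrite -lerBlDl; apply: le_trans (lerB_dist _ _) _.
apply: le_trans (generator_lipschitz _ _) _.
rewrite ler_piMr ?(ltW K0) // subr0 ger0_norm ?subr_ge0 //.
by rewrite -natr1 in xt; lra.
Qed.

End Generator.

Definition partial_G {R : realType} (g : R -> R) (delta : R) (m : nat) (x : R) : R :=
  \sum_(1 <= n < m) g (n%:R ^+ 2 * x) / n%:R `^ (1 + delta).

Section Series.
Variables (R : realType) (g : R -> R) (delta B : R).
Hypotheses (d0 : 0 < delta) (B0 : 0 < B) (gB : forall x, 0 <= x -> `|g x| <= B).

Lemma partial_G_sub_le (x : R) (m n : nat) : 0 <= x -> (0 < m <= n)%N ->
  `|partial_G g delta n.+1 x - partial_G g delta m.+1 x| <= B / delta * m%:R `^ (- delta).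
Proof.
move=> x0 /andP[m0 mn].
rewrite /partial_G (@big_cat_nat _ _ _ m.+1 1 n.+1) //= addrAC subrr add0r.
rewrite big_add1 /=; apply: le_trans (ler_norm_sum _ _ _) _.
apply: le_trans (_ : \sum_(m <= i < n) B * i.+1%:R `^ (- (1 + delta)) <= _).
  apply: ler_sum => i _; rewrite normrM normfV [X in _ / X]ger0_norm ?powR_ge0 // powRN.
  by rewrite ler_wpM2r ?invr_ge0 ?powR_ge0 // gB // mulr_ge0 // sqr_ge0.
rewrite -mulr_sumr -mulrA ler_wpM2l ?(ltW B0) // mulrC.
exact: sum_powR_tail_le.
Qed.

Lemma partial_G_cvg (x : R) : 0 <= x -> cvgn (fun m => partial_G g delta m x).
Proof.
move=> x0.
pose h n := g (n%:R ^+ 2 * x) / n%:R `^ (1 + delta).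
have h0 : h 0%N = 0 by rewrite /h powR0 ?invr0 ?mulr0 // gt_eqF // ltr_wpDl.
have sE m (F : nat -> R) : F 0%N = 0 -> series F m = \sum_(1 <= n < m) F n.
  by rewrite /series /= => F0; case: m => [|m]; [rewrite !big_geq | rewrite big_ltn // F0 add0r].
rewrite (_ : (fun m => _) = series h); last by apply/funext => m; rewrite sE.
have nE m : [normed series h] m = \sum_(1 <= n < m) `|h n|.
  by rewrite -(sE m (fun n => `|h n|)) ?h0 ?normr0.
apply: normed_cvg; apply: nondecreasing_is_cvgn.
  apply/nondecreasing_seqP => n; rewrite !nE.
  case: n => [|n]; first by rewrite !big_geq.
  by rewrite [leRHS]big_nat_recr //= lerDl.
exists (`|h 1%N| + B / delta * 1%:R `^ (- delta)) => _ [m _ <-]; rewrite nE.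
have b0 : 0 <= `|h 1%N| + B / delta * 1%:R `^ (- delta).
  by rewrite addr_ge0 // mulr_ge0 ?powR_ge0 // divr_ge0 ?ltW.
case: m => [|[|m]]; [by rewrite big_geq | by rewrite big_geq | ].
rewrite big_ltn // lerD2l big_add1 /=.
apply: le_trans (_ : \sum_(1 <= i < m.+1) B * i.+1%:R `^ (- (1 + delta)) <= _).
  apply: ler_sum => i _; rewrite /h normrM normfV [X in _ / X]ger0_norm ?powR_ge0 // powRN.
  by rewrite ler_wpM2r ?invr_ge0 ?powR_ge0 // gB // mulr_ge0 // sqr_ge0.
rewrite -mulr_sumr -mulrA ler_wpM2l ?(ltW B0) // mulrC.
exact: sum_powR_tail_le.
Qed.

Lemma G_tail_le (x : R) (m : nat) : 0 <= x -> (0 < m)%N ->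
  `|G g delta x - partial_G g delta m.+1 x| <= B / delta * m%:R `^ (- delta).
Proof.
move=> x0 m0; have cv := partial_G_cvg x0.
rewrite ler_distl; apply/andP; split.
  apply: limr_ge => //; exists m.+1 => // n /= mn.
  case: n mn => // n; rewrite ltnS => mn.
  have := @partial_G_sub_le x m n x0; rewrite m0 mn => /(_ isT).
  by rewrite ler_distl => /andP[].
apply: limr_le => //; exists m.+1 => // n /= mn.
case: n mn => // n; rewrite ltnS => mn.
have := @partial_G_sub_le x m n x0; rewrite m0 mn => /(_ isT).
by rewrite ler_distl => /andP[].
Qed.

Lemma partial_G_lipschitz (K : R) (m : nat) (x y : R) : 0 <= K ->
  (forall x y, `|g x - g y| <= K * `|x - y|) ->
  `|partial_G g delta m x - partial_G g delta m y| <= K * m%:R ^+ 3 * `|x - y|.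
Proof.
move=> K0 gK; rewrite /partial_G -sumrB.
apply: le_trans (ler_norm_sum _ _ _) _.
apply: le_trans (_ : \sum_(1 <= n < m) K * m%:R ^+ 2 * `|x - y| <= _).
  rewrite big_nat [leRHS]big_nat; apply: ler_sum => n /andP[n1 nm].
  rewrite -mulrBl normrM normfV [X in _ / X]ger0_norm ?powR_ge0 //.
  rewrite ler_pdivrMr ?powR_gt0 ?ltr0n //.
  apply: le_trans (gK _ _) _; rewrite -mulrBr normrM (ger0_norm (sqr_ge0 _)).
  have p1 : 1 <= n%:R `^ (1 + delta) :> R.
    by rewrite -[leLHS](powRr0 n%:R) ler_powR ?ler1n // addr_ge0 // ltW.
  apply: le_trans (_ : K * m%:R ^+ 2 * `|x - y| <= _); last first.
    by rewrite ler_peMr ?mulr_ge0 ?exprn_ge0.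
  by rewrite -mulrA ler_wpM2l // ler_wpM2r // lerXn2r ?nnegrE // ler_nat ltnW.
rewrite sumr_const_nat -[_ *+ (m - 1)]mulr_natr.
rewrite [leRHS](_ : _ = K * m%:R ^+ 2 * `|x - y| * m%:R); last by ring.
by rewrite ler_wpM2l ?mulr_ge0 ?exprn_ge0 // ler_nat leq_subr.
Qed.

End Series.

Lemma partial_G_sampled (R : realType) (g : R -> R) (delta : R) (Q J x : nat) :
  partial_G g delta (2 ^ J) (x%:R / Q%:R) =
  \sum_(j < J) sampled_block delta (fun m => g (m%:R / Q%:R)) j x.
Proof.
rewrite /partial_G; elim: J => [|J IHJ]; first by rewrite big_ord0 big_geq.
rewrite big_ord_recr -IHJ /= (@big_cat_nat _ _ _ (2 ^ J)) ?expn_gt0 ?leq_exp2l //=.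
congr (_ + _); rewrite /sampled_block -{1}[(2 ^ J)%N]add0n big_addn.
rewrite expnS mul2n -addnn addnK big_mkord.
apply: eq_bigr => i _; rewrite /coef [(2 ^ J + i)%N]addnC; congr (g _ / _).
by rewrite natrM natrX mulrA.
Qed.

(** * Oscillation of [G] *)

Lemma trunc_in_cell (R : realType) (N Q i : nat) (x : R) : (0 < N)%N -> (0 < Q)%N ->
  i%:R / N%:R <= x <= i.+1%:R / N%:R ->
  in_cell N Q i (Num.trunc (x * Q%:R)) /\
  `|x - (Num.trunc (x * Q%:R))%:R / Q%:R| <= Q%:R^-1.
Proof.
move=> N0 Q0 /andP[ix xi].
have NR : (0 : R) < N%:R by rewrite ltr0n.
have QR : (0 : R) < Q%:R by rewrite ltr0n.
have x0 : 0 <= x by apply: le_trans ix; rewrite divr_ge0.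
have /andP[] := truncn_itv (mulr_ge0 x0 (ltW QR)).
move: (Num.trunc _) => u ux xu.
rewrite ler_pdivrMr // in ix; rewrite ler_pdivlMr // in xi.
split.
  rewrite /in_cell /cell_start -ltnS ltn_divLR // leq_divRL //.
  rewrite -(ltr_nat R) -(ler_nat R) !natrM; apply/andP; split.
    apply: le_lt_trans (_ : x * N%:R * Q%:R < _); first by rewrite ler_pM2r.
    by rewrite mulrAC ltr_pM2r.
  apply: le_trans (_ : x * N%:R * Q%:R <= _); last by rewrite ler_pM2r.
  by rewrite mulrAC ler_pM2r.
rewrite ger0_norm; last by rewrite subr_ge0 ler_pdivrMr.
rewrite -natr1 -ltrBlDr in xu.
rewrite -(ler_pM2r QR) mulrBl divfK ?gt_eqF // mulVf ?gt_eqF //; lra.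
Qed.

Section Oscillation.
Variables (R : realType) (g : R -> R) (delta K B : R).
Hypotheses (d01 : 0 < delta <= 1) (g_per : periodic g 1).
Hypotheses (dg : forall x : R, derivable g x 1) (K0 : 0 < K) (B0 : 0 < B).
Hypothesis g'_lip : forall x y, `|derive1 g x - derive1 g y| <= K * `|x - y|.
Hypothesis gB : forall x, 0 <= x -> `|g x| <= B.

Lemma sum_partial_G_osc_le (N Q J : nat) (u v : nat -> nat) :
  (0 < N)%N -> (2 * N <= Q)%N -> prime Q -> (8 * (2 ^ J) ^ 2 <= Q)%N ->
  (forall i, in_cell N Q i (u i)) -> (forall i, in_cell N Q i (v i)) ->
  \sum_(i < N) `|partial_G g delta (2 ^ J) ((u i)%:R / Q%:R) -
                 partial_G g delta (2 ^ J) ((v i)%:R / Q%:R)| <=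
  1020 * (2 * K) * 33 * J.+2%:R ^+ 3 * N%:R `^ (3 / 4 - delta / 2).
Proof.
move=> N0 NQ pQ JQ uP vP.
have Q0 : (0 : R) < Q%:R by rewrite ltr0n prime_gt0.
pose f (m : nat) : R := g (m%:R / Q%:R).
have fQ m : f (m + Q)%N = f m by rewrite /f natrD mulrDl divff ?gt_eqF // g_per.
have fK m : `|f m.+2 - f m.+1 *+ 2 + f m| <= 2 * K / Q%:R ^+ 2.
  have := second_difference_le dg K0 g'_lip (m%:R / Q%:R) (_ : 0 <= Q%:R^-1).
  rewrite invr_ge0 (ltW Q0) => /(_ isT); rewrite -exprVn /f; congr (`|_| <= _).
  have -> : m.+2%:R / Q%:R = m%:R / Q%:R + Q%:R^-1 + Q%:R^-1 :> R.
    by rewrite -addn2 natrD; field; rewrite gt_eqF.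
  have -> : m.+1%:R / Q%:R = m%:R / Q%:R + Q%:R^-1 :> R.
    by rewrite -addn1 natrD; field; rewrite gt_eqF.
  by [].
pose P : R := N%:R `^ (3 / 4 - delta / 2).
have PE : N%:R * N%:R `^ (- (1 / 4) - delta / 2) = P.
  rewrite -{1}(powRr1 (_ : 0 <= N%:R)) // -powRD; last by rewrite pnatr_eq0 -lt0n N0 implybT.
  by rewrite /P; congr (_ `^ _); field.
have P0 : 0 <= P by exact: powR_ge0.
pose c : R := 1020 * (2 * K) * 33.
have c0 : 0 <= c.
  by apply: mulr_ge0 (mulr_ge0 (ler0n _ _) (mulr_ge0 (ler0n _ _) (ltW K0))) (ler0n _ _).
have cE : 1020 * (2 * K) * 33 = c by [].
clearbody c; rewrite cE.
apply: le_trans (_ : \sum_(i < N) \sum_(j < J)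
   `|sampled_block delta f j (u i) - sampled_block delta f j (v i)| <= _).
  apply: ler_sum => i _; rewrite !partial_G_sampled -/f -sumrB; exact: ler_norm_sum.
rewrite exchange_big /=.
apply: le_trans (_ : \sum_(j < J) c * J.+2%:R ^+ 2 * P <= _).
  apply: ler_sum => j _; have jJ := ltn_ord j.
  have jQ : (8 * (2 ^ j) ^ 2 <= Q)%N.
    by rewrite (leq_trans _ JQ) // leq_mul2l leq_sqr leq_exp2l // ltnW.
  apply: le_trans (sampled_block_osc_le d01 N0 NQ pQ jQ fQ fK uP vP) _.
  rewrite PE ler_wpM2r // natrM natrX.
  by rewrite mulrA cE ler_wpM2l // lerXn2r ?nnegrE // ler_nat !ltnS ltnW.
rewrite sumr_const card_ord -[_ *+ J]mulr_natr -/P.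
rewrite [leRHS](_ : _ = c * J.+2%:R ^+ 2 * P * J.+2%:R); last by rewrite exprS; ring.
by rewrite ler_wpM2l ?mulr_ge0 ?exprn_ge0 // ler_nat -addn2 leq_addr.
Qed.

(** The level [J] is such that the tail of the series is [O(1/N)], and the prime [Q] is so large that
replacing a point by the preceding sample point also costs [O(1/N)]; these errors add up to [O(1)]. *)
Lemma sum_G_osc_le (N J : nat) (x y : nat -> R) :
  (0 < N)%N -> (0 < J)%N -> N%:R <= (2 ^ J).-1%:R `^ delta ->
  (forall i, i%:R / N%:R <= x i <= i.+1%:R / N%:R) ->
  (forall i, i%:R / N%:R <= y i <= i.+1%:R / N%:R) ->
  \sum_(i < N) `|G g delta (x i) - G g delta (y i)| <=
  (1020 * (2 * K) * 33 + 2 * (B / delta + 1)) * J.+2%:R ^+ 3 * N%:R `^ (3 / 4 - delta / 2).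
Proof.
move=> N0 J0 NJ xP yP; have /andP[d0 d1] := d01.
have NR : (0 : R) < N%:R by rewrite ltr0n.
set M := (2 ^ J)%N in NJ *.
have M2 : (1 < M)%N by rewrite -[1%N]/(2 ^ 0)%N ltn_exp2l.
(* The three summands below ensure that each cell has sample points, that the squares in the blocks
are resolved, and that the Lipschitz partial sum changes by at most [1/N] between sample points. *)
pose T := Num.trunc (K * M%:R ^+ 3 * N%:R).
have [Q Qbig pQ] := prime_above (2 * N + 8 * M ^ 2 + T.+1).
have Q0 : (0 : R) < Q%:R by rewrite ltr0n prime_gt0.
have lipQ : K * M%:R ^+ 3 * Q%:R^-1 <= N%:R^-1.
  rewrite ler_pdivrMr // [leRHS]mulrC ler_pdivlMr // ltW //.
  apply: lt_le_trans (_ : T.+1%:R <= _); last first.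
    by rewrite ler_nat (leq_trans (leq_addl _ _) (ltnW Qbig)).
  have z0 : 0 <= K * M%:R ^+ 3 * N%:R by rewrite !mulr_ge0 ?exprn_ge0 // ltW.
  by have /andP[] := truncn_itv z0.
pose u i := Num.trunc (x i * Q%:R); pose v i := Num.trunc (y i * Q%:R).
have uP i := @trunc_in_cell R N Q i (x i) N0 (prime_gt0 pQ) (xP i).
have vP i := @trunc_in_cell R N Q i (y i) N0 (prime_gt0 pQ) (yP i).
have close (z : R) (w : nat) : 0 <= z -> `|z - w%:R / Q%:R| <= Q%:R^-1 ->
    `|G g delta z - partial_G g delta M (w%:R / Q%:R)| <= (B / delta + 1) / N%:R.
  move=> z0 zw.
  rewrite (_ : _ - _ = (G g delta z - partial_G g delta M z) +
     (partial_G g delta M z - partial_G g delta M (w%:R / Q%:R))); last by rewrite addrA subrK.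
  apply: le_trans (ler_normD _ _) _; rewrite mulrDl; apply: lerD.
    have M0 : (0 < M.-1)%N by rewrite -ltnS prednK // ltnW.
    have := G_tail_le d0 B0 gB z0 M0; rewrite prednK ?(ltnW M2) // => h.
    apply: le_trans h _; rewrite ler_wpM2l ?divr_ge0 ?(ltW B0) ?(ltW d0) //.
    by rewrite powRN lef_pV2 ?posrE // (lt_le_trans NR).
  apply: le_trans (partial_G_lipschitz d0 M z (w%:R / Q%:R) (ltW K0) _) _.
    exact: generator_lipschitz g_per dg K0 g'_lip.
  rewrite mul1r; apply: le_trans lipQ; rewrite ler_wpM2l // mulr_ge0 ?exprn_ge0 // ltW //.
have ge0 i (z : R) : i%:R / N%:R <= z <= i.+1%:R / N%:R -> 0 <= z.
  by move=> /andP[iz _]; apply: le_trans iz; rewrite divr_ge0.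
apply: le_trans (_ : \sum_(i < N) (2 * (B / delta + 1) / N%:R +
    `|partial_G g delta M ((u i)%:R / Q%:R) - partial_G g delta M ((v i)%:R / Q%:R)|) <= _).
  apply: ler_sum => i _.
  have := close (x i) (u i) (ge0 _ _ (xP i)) (uP i).2.
  have := close (y i) (v i) (ge0 _ _ (yP i)) (vP i).2.
  rewrite -[2 * _ / _]mulrA; move: (_ / N%:R) (G _ _ (x i)) (G _ _ (y i)) => e a b.
  move: (partial_G _ _ _ _) (partial_G _ _ _ _) => c d hb ha.
  rewrite (_ : a - b = (a - c) + (c - d) - (b - d)); last by ring.
  apply: le_trans (ler_normB _ _) _; have := ler_normD (a - c) (c - d); lra.
rewrite big_split /= sumr_const card_ord -[_ *+ N]mulr_natr divfK ?gt_eqF //.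
have NQ : (2 * N <= Q)%N by apply: leq_trans (ltnW Qbig); rewrite -addnA leq_addr.
have JQ : (8 * M ^ 2 <= Q)%N.
  exact: leq_trans (leq_trans (leq_addl _ _) (leq_addr _ _)) (ltnW Qbig).
have := @sum_partial_G_osc_le N Q J u v N0 NQ pQ JQ (fun i => (uP i).1) (fun i => (vP i).1).
rewrite -/M; move: (1020 * _ * _) => c; set P := N%:R `^ _ => h.
have P1 : 1 <= P by rewrite -[leLHS](powRr0 N%:R) ler_powR ?ler1n //; lra.
have J1 : 1 <= J.+2%:R ^+ 3 * P by rewrite mulr_ege1 // exprn_ege1 // ler1n.
have c0 : 0 <= 2 * (B / delta + 1) by rewrite mulr_ge0 // addr_ge0 // divr_ge0 ?(ltW B0) ?(ltW d0).
have := ler_wpM2l c0 J1; rewrite mulr1.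
move: (2 * (B / delta + 1)) h => e + h'; move: (\sum_(i < N) _) (J.+2%:R ^+ 3) h' => S j.
by rewrite mulrA; nra.
Qed.

Lemma G_bounded (x : R) : 0 <= x -> `|G g delta x| <= B + B / delta.
Proof.
move=> x0; have /andP[d0 d1] := d01.
have := G_tail_le d0 B0 gB x0 (isT : (0 < 1)%N).
rewrite /partial_G big_nat1 expr1n mul1r powR1 divr1 mulr1 => h.
have := gB x0; have := ler_normD (G g delta x - g x) (g x); rewrite subrK; lra.
Qed.

End Oscillation.

(** * From oscillations to boxes *)

Lemma bounded_int_set (S : set int) (m : nat) : (forall j, S j -> `|j| <= m%:Z) ->
  S !=set0 -> exists a b, [/\ S a, S b & forall j, S j -> a <= j <= b].
Proof.
move=> Sm [j0 Sj0].
pose P (n : nat) : bool := `[< S (n%:Z - m%:Z) >].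
have PS j : S j -> exists2 n : nat, P n & j = n%:Z - m%:Z.
  move=> Sj; have jm := Sm j Sj; exists (absz (j + m%:Z)); last by lia.
  by apply/asboolP; rewrite (_ : _ - _ = j) //; lia.
have exP : exists n, P n by have [n Pn _] := PS j0 Sj0; exists n.
have bP n : P n -> (n <= m + m)%N by move=> /asboolP /Sm; lia.
have [na Pna mina] := ex_minnP exP; have [nb Pnb maxb] := ex_maxnP exP bP.
exists (na%:Z - m%:Z), (nb%:Z - m%:Z); split; [exact/asboolP|exact/asboolP|].
move=> j /PS[n Pn ->]; have := mina n Pn; have := maxb n Pn; lia.
Qed.

Lemma counting_le_seq (T : choiceType) (R : realType) (A : set T) (s : seq T) (r : R) :
  (forall x, A x -> x \in s) -> (size s)%:R <= r -> (counting A <= r%:E)%E.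
Proof.
move=> As sr.
have AF : A `<=` [set` s] by move=> x /As.
have fA : finite_set A by apply: sub_finite_set AF _; exact: finite_seq.
rewrite /counting asboolT // lee_fin (le_trans _ sr) // ler_nat.
apply: uniq_leq_size; first exact: finmap.fset_uniq.
by move=> x; rewrite in_fset_set // inE => /As.
Qed.

Lemma le_itv_absz (a b j : int) : a <= b -> a <= j <= b ->
  a <= j < a + (absz (b - a + 1))%:Z.
Proof. lia. Qed.

Lemma natr_absz_itv (R : pzRingType) (a b : int) : a <= b ->
  (absz (b - a + 1))%:R = b%:~R - a%:~R + 1 :> R.
Proof.
move=> ab; rewrite -[LHS]/((absz (b - a + 1))%:Z%:~R) abszE ger0_norm; last by lia.
by rewrite rmorphD rmorphB.
Qed.

Lemma absz_offset (a j : int) (n : nat) : a <= j < a + n%:Z ->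
  (absz (j - a) < n)%N /\ a + (absz (j - a))%:Z = j.
Proof. by move=> /andP[aj jn]; split; lia. Qed.

Section Counting.
Variables (R : realType) (f : R -> R) (M : R) (N : nat).
Hypotheses (N0 : (0 < N)%N) (fM : forall x, 0 <= x <= 1 -> `|f x| <= M).

Let A : set (int * int) := [set ij | grid_square N ij `&` graph01 f !=set0].

(** The points [x] and [y] are abscissae of points of the graph in the lowest and in the highest box met
in the column; for a column without boxes they are arbitrary points of it and [n = 0]. The last
clause serves the columns [-1] and [N], which meet the strip [0 <= x <= 1] in a single point. *)
Lemma column_count (i : int) : exists t : (int * nat) * (R * R),
  let: ((lo, n), (x, y)) := t in
  [/\ i%:~R / N%:R <= x <= (i + 1)%:~R / N%:R, i%:~R / N%:R <= y <= (i + 1)%:~R / N%:R,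
      forall j, A (i, j) -> lo <= j < lo + n%:Z,
      n%:R <= N%:R * `|f x - f y| + 2 &
      (0 < n)%N -> 0 <= x <= 1 /\ 0 <= y <= 1].
Proof.
have NR : (0 : R) < N%:R by rewrite ltr0n.
have [S0|S0] := pselect ([set j | A (i, j)] !=set0); last first.
  exists ((0, 0%N), (i%:~R / N%:R, i%:~R / N%:R)); split=> //.
  - by rewrite lexx ler_pM2r ?invr_gt0 // ler_int; lia.
  - by rewrite lexx ler_pM2r ?invr_gt0 // ler_int; lia.
  - by move=> j Aj; case: S0; exists j.
  - by rewrite subrr normr0 mulr0 add0r.
have jb j : A (i, j) -> exists x, [/\ 0 <= x <= 1, i%:~R / N%:R <= x <= (i + 1)%:~R / N%:R &
    j%:~R <= N%:R * f x <= j%:~R + 1].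
  move=> [[x z] [[/= xi zj] [/= x01 zx]]]; exists x; split=> //.
  move: zj; rewrite zx ler_pdivrMr // ler_pdivlMr // intrD [f x * _]mulrC.
  by [].
have [|a [b [Aa Ab ab]]] := @bounded_int_set _ (Num.trunc (N%:R * M)).+2 _ S0.
  move=> j /= /jb[x [x01 _ jx]].
  have fxM := fM x01.
  have NM0 : 0 <= N%:R * M by rewrite mulr_ge0 ?(le_trans (normr_ge0 _) fxM).
  have /andP[_ tM] := truncn_itv NM0.
  have Nf : `|N%:R * f x| <= N%:R * M by rewrite normrM (ger0_norm (ltW NR)) ler_pM2l.
  rewrite -(ler_int R) intr_norm -[X in _ <= X]/(_.+2%:R : R).
  rewrite -natr1; move: Nf; rewrite !ler_norml => /andP[n1 n2]; lra.
have /jb[x [x01 xi ax]] := Aa; have /jb[y [y01 yi byy]] := Ab.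
have lab : a <= b by have /andP[] := ab b Ab.
exists ((a, absz (b - a + 1)), (x, y)); split=> //.
- by move=> j /ab; exact: le_itv_absz.
- rewrite natr_absz_itv //.
  have h : N%:R * f y - N%:R * f x <= N%:R * `|f x - f y|.
    by rewrite -mulrBr ler_pM2l // distrC ler_norm.
  lra.
Qed.

Lemma box_count_le (W : R) :
  (forall x y : nat -> R,
     (forall i, i%:R / N%:R <= x i <= i.+1%:R / N%:R) ->
     (forall i, i%:R / N%:R <= y i <= i.+1%:R / N%:R) ->
     \sum_(i < N) `|f (x i) - f (y i)| <= W) ->
  (box_count f N <= (N%:R * W + 2 * N%:R + 4)%:E)%E.
Proof.
move=> oscW.
have NR : (0 : R) < N%:R by rewrite ltr0n.
have [t tP] := choice column_count.
pose lo i := (t i).1.1; pose n i := (t i).1.2; pose x i := (t i).2.1; pose y i := (t i).2.2.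
have {}tP i : [/\ i%:~R / N%:R <= x i <= (i + 1)%:~R / N%:R,
   i%:~R / N%:R <= y i <= (i + 1)%:~R / N%:R,
   forall j, A (i, j) -> lo i <= j < lo i + (n i)%:Z,
   (n i)%:R <= N%:R * `|f (x i) - f (y i)| + 2 &
   (0 < n i)%N -> 0 <= x i <= 1 /\ 0 <= y i <= 1].
  by have := tP i; rewrite /lo /n /x /y; case: (t i) => [[? ?] [? ?]].
(* The columns run from [-1] to [N], since closed boxes to the left of [0] and to the right of [1]
touch the graph; the column [i] has the index [c = i + 1]. *)
pose column c := [seq (c%:Z - 1, lo (c%:Z - 1) + d%:Z) | d <- iota 0 (n (c%:Z - 1))].
apply: (@counting_le_seq _ _ _ (flatten [seq column c | c <- iota 0 N.+2])).
  move=> [i j] Aij.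
  have [x0 [ix xi x00 x01]] : exists x0 : R,
      [/\ i%:~R / N%:R <= x0, x0 <= (i + 1)%:~R / N%:R, 0 <= x0 & x0 <= 1].
    by have [[x0 z] [[/= /andP[ix xi] _] [/= /andP[x00 x01] _]]] := Aij; exists x0.
  have i1 : -1 <= i.
    have : (0 : R) <= (i + 1)%:~R
      by rewrite -(pmulr_lge0 _ (_ : 0 < N%:R^-1)) ?invr_gt0 // (le_trans x00).
    by rewrite ler0z -lerBlDr sub0r.
  have i2 : i < -1 + N.+2%:Z.
    have : (i%:~R : R) <= N%:Z%:~R by rewrite -[leRHS]mul1r -ler_pdivrMr // (le_trans ix).
    by rewrite ler_int => /le_lt_trans -> //; rewrite addrC intS addrAC subrr add0r ltz_nat.
  have [ci ie] : (absz (i - -1)%R < N.+2)%N /\ -1 + (absz (i - -1)%R)%:Z = i.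
    by apply: absz_offset; rewrite i1 i2.
  apply/flatten_mapP; exists (absz (i - -1)%R); first by rewrite mem_iota.
  have [_ _ /(_ j Aij) /absz_offset[nj je] _ _] := tP i.
  rewrite /column addrC ie; apply/mapP; exists (absz (j - lo i)); last by rewrite je.
  by rewrite mem_iota.
rewrite size_flatten /shape -map_comp sumnE big_map natr_sum.
under eq_bigr do rewrite /= size_map size_iota.
have edge i (c : R) :
    (forall z : R, 0 <= z <= 1 -> i%:~R / N%:R <= z <= (i + 1)%:~R / N%:R -> z = c) ->
    (n i)%:R <= 2 :> R.
  move=> zc; have [xi yi _ nle n01] := tP i.
  case: (posnP (n i)) => [->//|/n01[x01 y01]].
  by move: nle; rewrite (zc _ y01 yi) (zc _ x01 xi) subrr normr0 mulr0 add0r.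
have shift (i : nat) : i.+1%:Z - 1 = i%:Z by rewrite intS addrAC subrr add0r.
rewrite -[iota 0 N.+2]/(index_iota 0 N.+2) big_nat_recl // big_nat_recr //= big_mkord.
have nfirst : (n (0%:Z - 1))%:R <= 2 :> R.
  apply: (edge _ 0) => z /andP[z0 _] /andP[_]; rewrite subrK mul0r => z1.
  by apply/eqP; rewrite eq_le z0 z1.
have nlast : (n (N.+1%:Z - 1))%:R <= 2 :> R.
  apply: (edge _ 1) => z /andP[_ z1] /andP[+ _]; rewrite shift divff ?gt_eqF // => z0.
  by apply/eqP; rewrite eq_le z0 z1.
have nmid : \sum_(i < N) (n (i.+1%:Z - 1))%:R <= N%:R * W + 2 * N%:R :> R.
  apply: le_trans (_ : \sum_(i < N) (N%:R * `|f (x i) - f (y i)| + 2) <= _).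
    by apply: ler_sum => i _; rewrite shift; have [] := tP i.
  have two : \sum_(i < N) 2 = 2 * N%:R :> R by rewrite sumr_const card_ord mulr_natr.
  rewrite big_split /= two lerD2r -mulr_sumr.
  rewrite ler_wpM2l ?(ltW NR) //.
  by apply: (oscW (fun i => x i%:Z) (fun i => y i%:Z)) => i; have [] := tP i; rewrite addrC -intS.
move: nfirst nmid nlast; move: (n _)%:R (\sum_(i < N) _) (n _)%:R => p q r.
lra.
Qed.

End Counting.

(** * Logarithms and the upper limit *)

(** Logarithmically many dyadic blocks suffice for the tail of the series to be [O(1/N)]. *)
Lemma log_level_exists (R : realType) (delta : R) : 0 < delta ->
  exists2 c : R, 0 < c & forall N : nat, (0 < N)%N -> exists J : nat,
    [/\ (0 < J)%N, N%:R <= (2 ^ J).-1%:R `^ delta & J.+2%:R <= c * (1 + ln N%:R)].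
Proof.
move=> d0; have l2 : 0 < ln 2 :> R by rewrite ln_gt0 // ltr1n.
have dl0 : 0 < delta * ln 2 by rewrite mulr_gt0.
exists (4 + (delta * ln 2)^-1); first by rewrite addr_gt0 ?invr_gt0.
move=> N N0; have NR : (0 : R) < N%:R by rewrite ltr0n.
have lN : 0 <= ln N%:R :> R by rewrite ln_ge0 // ler1n.
have z0 : 0 <= ln N%:R / (delta * ln 2) by rewrite divr_ge0 // ltW.
have /andP[tz zt] := truncn_itv z0; set t := Num.trunc _ in tz zt.
(* [2 ^ t.+1 >= N ^ (1 / delta)]; one further doubling makes up for the predecessor. *)
exists t.+2; split=> //; last first.
  have -> : t.+4%:R = t%:R + 4 :> R by rewrite -addn4 natrD.
  rewrite mulrDl mulrDr mulr1 mulrDr mulr1 [_^-1 * _]mulrC.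
  have := invr_ge0 (delta * ln 2); rewrite (ltW dl0) => di; lra.
have le2 : (2 ^ t.+1 <= (2 ^ t.+2).-1)%N.
  rewrite [(2 ^ t.+2)%N]expnS mul2n -addnn -ltnS prednK ?addn_gt0 ?expn_gt0 //.
  by rewrite -[ltnLHS]addn0 ltn_add2l expn_gt0.
apply: le_trans (_ : (2 ^ t.+1)%:R `^ delta <= _); last first.
  by rewrite ge0_ler_powR ?nnegrE ?ler_nat // ltW.
have P0 : (0 : R) < (2 ^ t.+1)%:R by rewrite ltr0n expn_gt0.
rewrite -ler_ln ?posrE ?powR_gt0 // ln_powR natrX lnXn // -[ln 2 *+ _]mulr_natr.
rewrite ltr_pdivrMr // in zt; apply: ltW; rewrite (lt_le_trans zt) //.
by rewrite le_eqVlt; apply/orP; left; apply/eqP; ring.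
Qed.

Lemma box_count_ge0 (R : realType) (f : R -> R) N : (0 <= box_count f N)%E.
Proof. by rewrite /box_count /counting; case: ifP => // _; rewrite lee_fin. Qed.

Lemma ln_le_linear (R : realType) (eta y : R) : 0 < eta -> 0 < y ->
  ln y <= eta * y - ln eta.
Proof.
move=> e0 y0; have ey : 0 < eta * y by rewrite mulr_gt0.
have := @le_ln1Dx R (eta * y - 1); rewrite [1 + _]addrC subrK lnM ?posrE //.
by rewrite ltrBrDr addNr => /(_ ey); lra.
Qed.

(** The powers of [ln N] disappear because [ln (1 + z) <= eta (1 + z) - ln eta] for every [eta > 0], so
that the logarithm of the factor is at most [e ln N] for large [N]. *)
Lemma upper_box_dim_le (R : realType) (f : R -> R) (C c s : R) : 0 < C -> 0 < c ->
  (forall N : nat, (0 < N)%N ->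
    (box_count f N <= (C * (c * (1 + ln N%:R)) ^+ 3 * N%:R `^ s)%:E)%E) ->
  (upper_box_dim f <= s%:E)%E.
Proof.
move=> C0 c0 fC; apply/lee_addgt0Pr => e e0.
(* With this choice the logarithmic factor costs [3 * eta * c * (1 + ln N) = (e / 2) * (1 + ln N)]. *)
pose eta := e / (6 * c); have eta0 : 0 < eta by rewrite divr_gt0 // mulr_gt0.
pose D := ln C - 3 * ln eta + e / 2.
pose n0 := (Num.trunc (expR `|2 * D / e|)).+2.
rewrite /upper_box_dim /limn_esup /limf_esup.
apply: le_trans (_ : ereal_sup ((fun N => lne (box_count f N) / (ln N%:R)%:E)%E @`
    [set n | (n0 <= n)%N]) <= _)%E.
  by apply: ereal_inf_lbound; exists [set n | (n0 <= n)%N] => //; exists n0.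
apply: ge_ereal_sup => _ [N /= n0N <-].
have N1 : (1 < N)%N by apply: leq_trans n0N.
have N0 : (0 < N)%N by apply: ltnW.
have NR : (0 : R) < N%:R by rewrite ltr0n.
have zN : `|2 * D / e| <= ln N%:R.
  rewrite -ler_expR lnK ?posrE // ltW //.
  have /andP[_ h] := truncn_itv (expR_ge0 `|2 * D / e|).
  by apply: lt_le_trans h _; rewrite ler_nat; apply: ltnW.
have z0 : 0 < ln N%:R :> R by rewrite ln_gt0 // ltr1n.
set z := ln N%:R in zN z0 *.
have y0 : 0 < c * (1 + z) by rewrite mulr_gt0 // addr_gt0.
have r0 : 0 < C * (c * (1 + z)) ^+ 3 * N%:R `^ s.
  by rewrite mulr_gt0 ?powR_gt0 // mulr_gt0 // exprn_gt0.
rewrite inver gt_eqF // lee_pdivrMr //.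
apply: le_trans (_ : lne (C * (c * (1 + z)) ^+ 3 * N%:R `^ s)%:E <= _)%E.
  rewrite lee_lne ?fC // in_itv /= leey andbT; first exact: box_count_ge0.
  by rewrite lee_fin ltW.
rewrite lne_EFin // -EFinD -EFinM lee_fin.
have y3 : 0 < (c * (1 + z)) ^+ 3 by rewrite exprn_gt0.
rewrite lnM ?posrE ?powR_gt0 ?(mulr_gt0 C0 y3) // lnM ?posrE //.
rewrite lnXn // ln_powR -/z.
have := ln_le_linear eta0 y0.
have -> : eta * (c * (1 + z)) = e / 6 * (1 + z).
  by rewrite /eta; field; rewrite gt_eqF.
move: (ln (c * _)) => w hw.
have : 2 * D / e <= z by apply: le_trans zN; exact: ler_norm.
rewrite ler_pdivrMr // /D -[w *+ 3]mulr_natr => hD.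
move: (ln eta) (ln C) hw hD => a b hw hD; nra.
Qed.

Theorem theorem1p3 (R : realType) (delta : R) (g : R -> R)
    (hdelta : 0 < delta <= 1)
    (g_periodic : periodic g 1)
    (g_derivable : forall x : R, derivable g x 1)
    (g'_lipschitz : lipschitz (derive1 g)) :
  (upper_box_dim (G g delta) <= (7 / 4 - delta / 2)%:E)%E.
Proof.
have /andP[d0 d1] := hdelta.
have [K K0 g'K] := lipschitz_bound g'_lipschitz.
have [B B0 gB] := generator_bounded g_periodic g_derivable K0 g'K.
have [c c0 levelP] := log_level_exists d0.
pose C1 := 1020 * (2 * K) * 33 + 2 * (B / delta + 1).
have C10 : 0 <= C1.
  apply: addr_ge0.
    by apply: mulr_ge0 (mulr_ge0 (ler0n _ _) (mulr_ge0 (ler0n _ _) (ltW K0))) (ler0n _ _).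
  by rewrite mulr_ge0 // addr_ge0 // divr_ge0 // ltW.
have osc := sum_G_osc_le hdelta g_periodic g_derivable K0 B0 g'K gB.
rewrite -/C1 in osc; clearbody C1.
apply: (@upper_box_dim_le _ _ (C1 + 6) c) => //; first by rewrite ltr_wpDl.
move=> N N0; have [J [J0 NJ Jc]] := levelP N N0.
have NR1 : (1 : R) <= N%:R by rewrite ler1n.
have GB (x : R) : 0 <= x <= 1 -> `|G g delta x| <= B + B / delta.
  by move=> /andP[x0 _]; exact: G_bounded.
apply: le_trans (box_count_le N0 GB (fun x y => osc N J x y N0 J0 NJ)) _.
rewrite lee_fin.
set P := N%:R `^ (3 / 4 - delta / 2); set j := J.+2%:R ^+ 3.
have -> : N%:R `^ (7 / 4 - delta / 2) = N%:R * P.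
  rewrite -{2}(powRr1 (_ : 0 <= N%:R)) // -powRD; last by rewrite pnatr_eq0 -lt0n N0 implybT.
  by congr (_ `^ _); field.
have P1 : 1 <= P by rewrite -[leLHS](powRr0 N%:R) ler_powR //; lra.
have j1 : 1 <= j by rewrite exprn_ege1 // ler1n.
have NP : 1 <= N%:R * P by rewrite mulr_ege1.
have jJ : j <= (c * (1 + ln N%:R)) ^+ 3.
  by rewrite lerXn2r ?nnegrE // (le_trans _ Jc).
apply: le_trans (_ : (C1 + 6) * j * (N%:R * P) <= _); last first.
  by rewrite ler_wpM2r ?(le_trans ler01 NP) // ler_wpM2l // addr_ge0.
have jNP : N%:R * P <= j * (N%:R * P) by rewrite ler_peMl // (le_trans ler01 NP).
have NNP : N%:R <= N%:R * P by rewrite ler_peMr // (le_trans ler01 NR1).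
rewrite (_ : N%:R * (C1 * j * P) = C1 * (j * (N%:R * P))); last by ring.
rewrite (_ : (C1 + 6) * j * (N%:R * P) =
  C1 * (j * (N%:R * P)) + 6 * (j * (N%:R * P))); last by ring.
lra.
Qed.
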